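(* Let $\Omega\subset\mathbb{R}^n$ be a Boman domain with constant $N\ge1$, let $Q_0$ be the fixed Whitney cube that is the common starting point of the chains in the corresponding chain decomposition of $\Omega$, and let $w$ be a doubling weight in $\Omega$ with constant $D$. If $u\in L^1_{\mathrm{loc}}(\Omega;w\,dx)$ and $1\le p<\infty$, then $$\int_\Omega|u(x)-u_{w;Q_0^*}|^p\,w(x)\,dx\le C(n,p,D,N)\sum_{Q\in\mathcal{W}(\Omega)}\int_{Q^*}|u(x)-u_{w;Q^*}|^p\,w(x)\,dx.$$
   Context: A cube in $\mathbb{R}^n$ is a half-open set $[a_1,b_1)\times\cdots\times[a_n,b_n)$ with equal side lengths; $Q(x_Q,r_Q)$ is the cube with midpoint $x_Q$ and side length $l(Q)=2r_Q$, and $NQ=Q(x_Q,Nr_Q)$. Whitney decomposition: $\mathcal{W}(\Omega)$ is the standard Whitney decomposition of the open set $\Omega\subsetneq\mathbb{R}^n$ into pairwise disjoint half-open dyadic cubes with $\bigcup_{Q\in\mathcal{W}(\Omega)}Q=\Omega$ and $\sqrt n\,l(Q)\le d(Q,\mathbb{R}^n\setminus\Omega)\le 4\sqrt n\,l(Q)$. For $Q\in\mathcal{W}(\Omega)$, $Q^*=\frac98Q\subset\Omega$; these satisfy $\sum_{Q}\chi_{Q^*}\le C(n)$ and $l(Q^* )/C(n)\le d(Q^*,\partial\Omega)\le C(n)l(Q^* )$. Chains: for a bounded domain $\Omega$, a tuple $\mathcal{C}(Q)=(Q_0,\dots,Q_k)$ of Whitney cubes is a chain joining $Q_0$ to $Q=Q_k$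 if $Q_i\ne Q_j$ for $i\ne j$ and for each $j\in\{1,\dots,k\}$ there is a cube $R\subset Q_j^*\cap Q_{j-1}^*$ with $l(R)\ge c(n)\max\{l(Q_j^* ),l(Q_{j-1}^* )\}$, where $c(n)>0$ is a fixed dimensional constant. A chain decomposition of $\Omega$ is a collection $\{\mathcal{C}(Q):Q\in\mathcal{W}(\Omega)\}$ of such chains, all starting from one fixed Whitney cube $Q_0$. The shadow of $R\in\mathcal{W}(\Omega)$ is $\mathcal{S}(R)=\{Q\in\mathcal{W}(\Omega):R\in\mathcal{C}(Q)\}$. $\Omega$ is a Boman domain with constant $N\ge1$ if it is a bounded domain having a chain decomposition with $\bigcup_{Q\in\mathcal{S}(R)}Q\subset NR$ for all $R\in\mathcal{W}(\Omega)$. A weight in $\Omega$ is a locally integrable function on $\Omega$ that is positive almost everywhere; $w(E)=\int_Ew(x)\,dx$. A weight $w$ is doubling in $\Omega$ with constant $D$ if $w(\Omega\cap Q(x,2r))\le D\,w(\Omega\cap Q(x,r))$ for every $x\in\Omega$ and $r>0$. $L^1_{\mathrm{loc}}(\Omega;w\,dx)$ is the set of functions integrable with respect to $w\,dx$ on every compact subset of $\Omega$, and $u_{w;E}=\frac{1}{w(E)}\int_Eu(x)w(x)\,dx$. *)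

(* Defs.v *)
From HB Require Import structures.
From mathcomp Require Import all_boot all_order all_algebra.
From mathcomp Require Import all_classical all_reals all_analysis.
Set Implicit Arguments.
Unset Strict Implicit.
Unset Printing Implicit Defensive.
Import Order.TTheory GRing.Theory Num.Theory.
Import numFieldNormedType.Exports.
Local Open Scope classical_set_scope.
Local Open Scope ring_scope.

Definition rV_display : measure_display -> measure_display.
Proof. exact. Qed.

Section measurable_rV.
Context {d} {T : measurableType d} (n : nat).

Let coors (i : 'I_n) (x : 'rV[T]_n) : T := x ord0 i.

Let rV_set0 : g_sigma_preimage coors set0.
Proof. exact: sigma_algebra0. Qed.

Let rV_setC A : g_sigma_preimage coors A -> g_sigma_preimage coors (~` A).
Proof. exact: sigma_algebraC. Qed.

Let rV_bigcup (F : _^nat) : (forall i, g_sigma_preimage coors (F i)) ->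
  g_sigma_preimage coors (\bigcup_i (F i)).
Proof. exact: sigma_algebra_bigcup. Qed.

(* The sigma-algebra on row vectors generated by the coordinates; over R this
   is the Borel sigma-algebra of R^n. *)
HB.instance Definition _ := @isMeasurable.Build (rV_display d)
  'rV[T]_n (g_sigma_preimage coors) rV_set0 rV_setC rV_bigcup.


End measurable_rV.

Lemma measurable_fun_rVP d1 d2 (T1 : measurableType d1) (T2 : measurableType d2)
    n (f : T1 -> 'rV[T2]_n) :
  (forall i, measurable_fun setT (fun x => f x ord0 i)) ->
  measurable_fun setT f.
Proof.
move=> mf; have : g_sigma_preimage (fun i x => f x ord0 i) `<=` measurable.
  apply: smallest_sub; first exact: sigma_algebra_measurable.
  case: n => [|n] in f mf *; first by rewrite big_ord0.
  rewrite -bigcup_mkord_ord; apply: bigcup_sub => i Ii.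
  by move=> A [B mB <-]; exact: mf.
rewrite (g_sigma_preimage_comp (fun i (x : 'rV[T2]_n) => x ord0 i) f) => prefS.
by move=> _ A mA; apply: prefS; exists A.
Qed.

Lemma measurable_coord d (T : measurableType d) n (i : 'I_n) :
  measurable_fun setT (fun x : 'rV[T]_n => x ord0 i).
Proof.
move=> _ Y mY; rewrite setTI; apply: sub_sigma_algebra => /=.
rewrite -bigcup_seq/=; exists i => /=; first by rewrite mem_index_enum.
by exists Y => //; rewrite setTI.
Qed.

Definition rV_cons T n (tx : T * 'rV[T]_n) : 'rV[T]_n.+1 :=
  row_mx (\row_(_ < 1) tx.1) tx.2.

Lemma measurable_rV_cons d (T : measurableType d) n :
  measurable_fun setT (@rV_cons T n).
Proof.
apply: measurable_fun_rVP => i; case: (@split_ordP 1 n i) => j ->.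
  rewrite (_ : (fun _ => _) = fst) //; apply/funext => x.
  exact: (etrans (row_mxEl _ _ _ _) (mxE _ _ _ _)).
rewrite (_ : (fun _ => _) = (fun y : 'rV[T]_n => y ord0 j) \o snd).
  by apply: measurableT_comp => //; exact: measurable_coord.
by apply/funext => x; exact: row_mxEr.
Qed.

Definition rV_uncons T n (x : 'rV[T]_n.+1) : T * 'rV[T]_n :=
  (x ord0 ord0, \row_j x ord0 (lift ord0 j)).

Lemma rV_consK T n : @rV_uncons T n \o @rV_cons T n = id.
Proof.
apply/funext => -[t x]; rewrite /= /rV_uncons; congr pair.
  rewrite (_ : ord0 = lshift n (ord0 : 'I_1)); last exact/val_inj.
  by rewrite [LHS]row_mxEl mxE.
by apply/rowP => j; rewrite mxE -rshift1 [LHS]row_mxEr.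
Qed.

Lemma measurable_rV_uncons d (T : measurableType d) n :
  measurable_fun setT (@rV_uncons T n).
Proof.
apply/measurable_fun_pairP; split; first exact: measurable_coord.
apply: measurable_fun_rVP => i.
rewrite (_ : (fun _ => _) = (fun y : 'rV[T]_n.+1 => y ord0 (lift ord0 i))).
  exact: measurable_coord.
by apply/funext => x; rewrite mxE.
Qed.

Section product_cons.
Context d (T : measurableType d) {R : realType}.
Local Open Scope ereal_scope.
Variables (m1 : {sigma_finite_measure set T -> \bar R}) (n : nat).
Variable m : {sigma_finite_measure set 'rV[T]_n -> \bar R}.

Definition product_cons : set 'rV[T]_n.+1 -> \bar R :=
  pushforward (m1 \x m) (@rV_cons T n).

Let product_cons0 : product_cons set0 = 0.
Proof. by rewrite /product_cons /pushforward preimage_set0 measure0. Qed.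

Let product_cons_ge0 A : 0 <= product_cons A.
Proof. exact: (measure_ge0 (m1 \x m)). Qed.

Let product_cons_sigma_additive : semi_sigma_additive product_cons.
Proof.
move=> F mF tF mUF.
have mc := @measurable_rV_cons _ T n.
rewrite /product_cons /pushforward preimage_bigcup.
apply: (@measure_semi_sigma_additive _ _ _ (m1 \x m)).
- by move=> k; rewrite -[X in measurable X]setTI; exact: mc.
- apply/trivIsetP => /= i j _ _ ij; rewrite -preimage_setI.
  by move/trivIsetP : tF => /(_ _ _ _ _ ij) ->//; rewrite preimage_set0.
- by rewrite -preimage_bigcup -[X in measurable X]setTI; exact: mc.
Qed.

HB.instance Definition _ := isMeasure.Build _ _ _ product_cons
  product_cons0 product_cons_ge0 product_cons_sigma_additive.

Let product_cons_sigma_finite : sigma_finite setT product_cons.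
Proof.
have /sigma_finiteP[F [TF ndF Foo]] := sigma_finiteT m1.
have /sigma_finiteP[G [TG ndG Goo]] := sigma_finiteT m.
exists (fun k => @rV_uncons T n @^-1` (F k `*` G k)).
  rewrite -preimage_bigcup (_ : \bigcup_k _ = setT) ?preimage_setT//.
  apply/seteqP; split=> // -[x y] _.
  have [[a _ Fa] [b _ Gb]] : (\bigcup_k F k) x /\ (\bigcup_k G k) y.
    by rewrite -TF -TG.
  exists (maxn a b) => //; split.
  - by move: x Fa; exact/subsetPset/ndF/leq_maxl.
  - by move: y Gb; exact/subsetPset/ndG/leq_maxr.
move=> k; have [mF Fk] := Foo k; have [mG Gk] := Goo k.
have mFG : measurable (F k `*` G k) by exact: measurableX.
split; first by rewrite -[X in measurable X]setTI; exact: measurable_rV_uncons.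
rewrite /product_cons /pushforward -comp_preimage rV_consK preimage_id.
by rewrite product_measure1E// lte_mul_pinfty// ge0_fin_numE.
Qed.

HB.instance Definition _ := Measure_isSigmaFinite.Build _ _ _ product_cons
  product_cons_sigma_finite.

End product_cons.

Section lebesgue_rV.
Context {R : realType}.
Local Notation RR := (measurableTypeR R).

(* n-fold product of the one-dimensional Borel-Lebesgue measure. *)
Fixpoint product_rV n : {sigma_finite_measure set 'rV[RR]_n -> \bar R} :=
  if n is n'.+1 then product_cons (@lebesgue_measure R) (product_rV n')
  else (\d_ (0 : 'rV[RR]_0)).

(* The underlying type is 'rV[R]_n, its measurable sets are all the
   Lebesgue-measurable sets. *)
Definition lebesgue_space (n : nat) : measurableType _ :=
  caratheodory_type ((product_rV n)^*)%mu.

Definition lebesgue_rV (n : nat) : set _ -> \bar R :=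
  @completed_measure_extension _ _ _ (product_rV n).

HB.instance Definition _ n := Measure.on (@lebesgue_rV n).

Let lebesgue_rV_sigma_finite n : sigma_finite setT (@lebesgue_rV n).
Proof. exact/completed_measure_extension_sigma_finite/sigma_finiteT. Qed.

HB.instance Definition _ n := @Measure_isSigmaFinite.Build _ _ _
  (@lebesgue_rV n) (@lebesgue_rV_sigma_finite n).

End lebesgue_rV.
Arguments lebesgue_rV {R} n.
Arguments lebesgue_space {R} n.

Section box.
Context {R : realType}.
Local Notation RR := (measurableTypeR R).
Definition box n (a b : 'rV[R]_n) : set 'rV[R]_n :=
  [set x | forall i, a ord0 i <= x ord0 i < b ord0 i].

Lemma measurable_box n (a b : 'rV[R]_n) :
  measurable (box a b : set 'rV[RR]_n).
Proof.
have -> : box a b = \bigcap_(i in [set: 'I_n])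
    [set x : 'rV[RR]_n | x ord0 i \in `[a ord0 i, b ord0 i[ ].
  apply/seteqP; split=> x /= h i; first by move=> _; rewrite /= in_itv/= h.
  by have := h i I; rewrite /= in_itv.
apply: fin_bigcap_measurable => // i _; rewrite -[X in measurable X]setTI.
exact: (@measurable_coord _ RR n i measurableT _ (measurable_itv `[a ord0 i, b ord0 i[)).
Qed.

Lemma product_rV_box n (a b : 'rV[R]_n) : (forall i, a ord0 i <= b ord0 i) ->
  product_rV n (box a b) = (\prod_(i < n) (b ord0 i - a ord0 i))%:E.
Proof.
elim: n a b => [|n IH] a b ab.
  rewrite big_ord0 /= diracE mem_set//; by case.
rewrite /= /product_cons /pushforward.
pose sh (v : 'rV[R]_n.+1) : 'rV[R]_n := \row_j v ord0 (lift ord0 j).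
have -> : @rV_cons RR n @^-1` box a b = `[a ord0 ord0, b ord0 ord0[%classic `*` box (sh a) (sh b).
  apply/seteqP; split=> -[t x] /=.
    have e := rV_consK RR n; have := congr1 (fun f => f (t, x)) e => /= -[e1 e2].
    move=> h; split=> [|i]; first by rewrite in_itv /= -{1 2}e1; exact: h.
    by rewrite !mxE -e2 mxE; exact: h.
  have e := rV_consK RR n; have := congr1 (fun f => f (t, x)) e => /= -[e1 e2].
  rewrite in_itv/= => -[h0 h] i; have [->|i0] := eqVneq i ord0; first by rewrite e1.
  case: (unliftP ord0 i) i0 => [j ->|->]; last by rewrite eqxx.
  by move=> _; have := h j; rewrite -{1 2}e2 !mxE.
rewrite product_measure1E//; last exact: measurable_box.
rewrite IH; last by move=> i; rewrite !mxE.
rewrite big_ord_recl EFinM; congr (_ * _)%E; last first.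
  by congr EFin; apply: eq_bigr => i _; rewrite !mxE.
have := @lebesgue_measure_itv R `[a ord0 ord0, b ord0 ord0[ => /= ->.
rewrite lte_fin EFinB; case: ltP => // h.
have /eqP -> : b ord0 ord0 == a ord0 ord0 by rewrite eq_le h ab.
by rewrite subee.
Qed.

Lemma lebesgue_rV_box n (a b : 'rV[R]_n) : (forall i, a ord0 i <= b ord0 i) ->
  lebesgue_rV n (box a b) = (\prod_(i < n) (b ord0 i - a ord0 i))%:E.
Proof.
move=> ab; rewrite -product_rV_box//.
exact: (measurable_mu_extE _ (measurable_box a b)).
Qed.
End box.

Section cubes.
Context {R : realType} {n : nat}.

(* The pair (x, r) stands for the cube Q(x, r), of midpoint x and side 2r. *)
Definition cube : Type := ('rV[R]_n * R)%type.

Definition cube_set (Q : cube) : set 'rV[R]_n :=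
  [set x | forall i, Q.1 ord0 i - Q.2 <= x ord0 i < Q.1 ord0 i + Q.2].

Definition side (Q : cube) : R := 2 * Q.2.

Definition dilate (t : R) (Q : cube) : cube := (Q.1, t * Q.2).

Definition star (Q : cube) : cube := dilate (9 / 8) Q.

Definition dyadic (Q : cube) : Prop :=
  exists (k : int) (m : 'I_n -> int),
    side Q = 2 ^ k /\ forall i, Q.1 ord0 i - Q.2 = (m i)%:~R * 2 ^ k.

(* The norm of 'rV[R]_n is the max norm, hence a separate Euclidean distance. *)
Definition edist (x y : 'rV[R]_n) : R :=
  Num.sqrt (\sum_(i < n) (x ord0 i - y ord0 i) ^+ 2).

Definition set_edist (A B : set 'rV[R]_n) : R :=
  inf [set edist x y | x in A & y in B].

Definition whitney (Omega : set 'rV[R]_n) (W : set cube) : Prop :=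
  [/\ forall Q, W Q -> dyadic Q,
      trivIset W cube_set,
      \bigcup_(Q in W) cube_set Q = Omega &
      forall Q, W Q ->
        Num.sqrt n%:R * side Q <= set_edist (cube_set Q) (~` Omega)
          <= 4 * Num.sqrt n%:R * side Q].

Definition bounded_domain (Omega : set 'rV[R]_n) : Prop :=
  [/\ open Omega, connected Omega, Omega !=set0 & bounded_set Omega].

Definition chain_link (c : R) (P Q : cube) : Prop :=
  exists S : cube,
    [/\ 0 < S.2,
        cube_set S `<=` cube_set (star Q) `&` cube_set (star P) &
        c * Num.max (side (star Q)) (side (star P)) <= side S].

Definition chain (c : R) (W : set cube) (Q0 Q : cube) (s : seq cube) : Prop :=
  [/\ ohead s = Some Q0 /\ last Q0 s = Q,
      forall P, P \in s -> W P,
      uniq s &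
      forall j, (0 < j < size s)%N -> chain_link c (nth Q0 s j.-1) (nth Q0 s j)].

Definition chain_decomposition (c : R) (W : set cube) (Q0 : cube)
    (Ch : cube -> seq cube) : Prop :=
  W Q0 /\ forall Q, W Q -> chain c W Q0 Q (Ch Q).

Definition shadow (W : set cube) (Ch : cube -> seq cube) (S : cube) : set cube :=
  [set Q | W Q /\ S \in Ch Q].

(* Omega is a Boman domain with constant N, as witnessed by the chain
   decomposition Ch starting from Q0. *)
Definition boman (c N : R) (Omega : set 'rV[R]_n) (W : set cube) (Q0 : cube)
    (Ch : cube -> seq cube) : Prop :=
  [/\ bounded_domain Omega,
      chain_decomposition c W Q0 Ch &
      forall S, W S ->
        \bigcup_(Q in shadow W Ch S) cube_set Q `<=` cube_set (dilate N S)].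

Local Notation mu := (@lebesgue_rV R n).

Definition weight (Omega : set 'rV[R]_n) (w : 'rV[R]_n -> R) : Prop :=
  (forall K : set 'rV[R]_n, compact K -> K `<=` Omega ->
     mu.-integrable K (EFin \o w)) /\
  {ae mu, forall x : 'rV[R]_n, Omega x -> 0 < w x}.

Definition wmeas (w : 'rV[R]_n -> R) (E : set 'rV[R]_n) : \bar R :=
  (\int[mu]_(x in E) (w x)%:E)%E.

Definition doubling (Omega : set 'rV[R]_n) (D : R) (w : 'rV[R]_n -> R) : Prop :=
  forall (x : 'rV[R]_n) (r : R), Omega x -> 0 < r ->
    (wmeas w (Omega `&` cube_set (x, 2 * r)%R)
       <= D%:E * wmeas w (Omega `&` cube_set (x, r)))%E.

Definition L1loc (Omega : set 'rV[R]_n) (w u : 'rV[R]_n -> R) : Prop :=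
  forall K : set 'rV[R]_n, compact K -> K `<=` Omega ->
    measurable_fun (K : set (lebesgue_space n)) (u : lebesgue_space n -> R) /\
    mu.-integrable K (fun x => (u x * w x)%:E).

Definition wmean (w : 'rV[R]_n -> R) (E : set 'rV[R]_n) (u : 'rV[R]_n -> R) : R :=
  (fine (wmeas w E))^-1 * \int[mu]_(x in E) (u x * w x).

End cubes.
Arguments cube R n : clear implicits.

(* Main.v *)
Require Import Defs.
From mathcomp Require Import all_boot all_order all_algebra.
From mathcomp Require Import all_classical all_reals all_analysis.
From mathcomp Require Import measurable_realfun ring lra.
Import Order.TTheory GRing.Theory Num.Theory.
Import numFieldNormedType.Exports.
Local Open Scope classical_set_scope.
Local Open Scope ring_scope.

(** Put [a_Q = (w(Q)^-1 int_{Q^*} |u - u_{w;Q^*}|^p w)^(1/p)].  Two consecutive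
    cubes of a chain share a cube of comparable size, on which [w] has
    comparable mass by doubling, so their means differ by at most a constant
    times the sum of the two [a]'s; telescoping,
    [|u_{w;Q^*} - u_{w;Q_0^*}|] is bounded by the sum of the [a_P] over
    [P] in [C(Q)].  It remains to bound [sum_Q w(Q) (sum_{P in C(Q)} a_P)^p] by
    [sum_P w(P) a_P^p].  The map [a |-> (sum_{P in C(Q)} a_P)_Q] is dual to
    [g |-> (w(P)^-1 sum_{Q in S(P)} g(Q) w(Q))_P].  Since [S(P)] lies in [N P],
    Vitali's covering lemma for the cubes [N P] and doubling make the latter of
    weak type (1,1); it is bounded on sup norms, hence on every [L^q], [q > 1],
    by Marcinkiewicz interpolation.  Of the means
    [u_{w;Q^*}] only the fact that they are constants is used. *)

(** * Averages over shadows *)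

(** A discrete layer-cake bound: the largest level [d * 2 ^+ i] below [x] is at least [x / 2], so
    its term alone suffices. *)
Lemma le_dyadic_sum (R : realType) (q d x : R) (k : nat) : 0 <= q -> 0 < d ->
  d < x <= d * 2 ^+ k ->
  x `^ q <= \sum_(i < k | d * 2 ^+ i < x) (2 * (d * 2 ^+ i)) `^ q.
Proof.
move=> q0 d0; elim: k => [|k IH] /andP[dx xk].
  by move: xk; rewrite expr0 mulr1 leNgt dx.
have dk : 0 <= d * 2 ^+ k by rewrite mulr_ge0 ?exprn_ge0 ?ltW.
rewrite big_mkcond big_ord_recr /= -big_mkcond /=.
case: (leP x (d * 2 ^+ k)) => xk'.
  by rewrite addr0 IH ?dx.
rewrite -[leLHS]add0r lerD ?sumr_ge0// => [i _|]; first exact: powR_ge0.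
have x0 : 0 <= x by rewrite (le_trans _ (ltW dx)) ?ltW.
apply: ge0_ler_powR; rewrite ?nnegrE ?mulr_ge0 ?(ltW d0)//.
by move: xk; rewrite exprS mulrCA.
Qed.

(** A geometric series dominated by its top term: when [d * 2 ^+ k < y], the lower levels lie below
    [y / 2], so induction at [y / 2] gains the factor [h], and [h / (1 - h) + 1 = 1 / (1 - h)]. *)
Lemma dyadic_sum_le (R : realType) (r d y : R) (k : nat) : 0 < r -> 0 < d -> 0 <= y ->
  \sum_(i < k | d * 2 ^+ i < y) (d * 2 ^+ i) `^ r <= (1 - 2^-1 `^ r)^-1 * y `^ r.
Proof.
move=> r0 d0; set h := 2^-1 `^ r.
have h1 : 0 < 1 - h.
  rewrite subr_gt0 /h -[ltRHS](_ : 1 `^ r = 1); last by rewrite powR1.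
  by apply: gt0_ltr_powR; rewrite ?nnegrE//; lra.
elim: k y => [|k IH] y y0.
  by rewrite big_ord0 mulr_ge0 ?powR_ge0// invr_ge0 ltW.
rewrite big_mkcond big_ord_recr /= -big_mkcond /=.
have dk i : 0 <= d * 2 ^+ i by rewrite mulr_ge0 ?exprn_ge0 ?ltW.
case: (ltP (d * 2 ^+ k) y) => ky; last by rewrite addr0; exact: IH.
have y2 : 0 <= 2^-1 * y by rewrite mulr_ge0.
have -> : \sum_(i < k | d * 2 ^+ i < y) (d * 2 ^+ i) `^ r =
          \sum_(i < k | d * 2 ^+ i < 2^-1 * y) (d * 2 ^+ i) `^ r.
  apply: eq_bigl => i; rewrite ltr_pdivlMl// mulrCA -exprS.
  have : d * 2 ^+ i.+1 < y.
    by apply: le_lt_trans ky; rewrite ler_pM2l// ler_eXn2l ?ltr1n.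
  move=> h2; rewrite h2; apply: le_lt_trans h2.
  by rewrite ler_pM2l// ler_eXn2l ?ltr1n.
apply: (le_trans (lerD (IH _ y2) (_ : _ <= y `^ r))).
  by rewrite ge0_ler_powR ?nnegrE ?(ltW r0)// ltW.
rewrite powRM// -/h.
rewrite -(ler_pM2l h1) mulrDr !mulrA divff ?gt_eqF// !mul1r; lra.
Qed.

Section averages.
Variables (R : realType) (I : finType) (m : I -> R) (S : rel I) (K : R).
Hypothesis m_ge0 : forall P, 0 <= m P.
Hypothesis K1 : 1 <= K.
Hypothesis shadow_le : forall P, \sum_(Q | S P Q) m Q <= K * m P.
(** [S P Q] stands for [Q] lying in the shadow of [P]. This is the form in which Vitali's lemma is
    used: the shadows of the selected cubes are pairwise disjoint. *)
Hypothesis covering : forall A : pred I, exists t : {set I},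
  [/\ {subset t <= A}, \sum_(P | A P) m P <= K * \sum_(P in t) m P &
      forall Q, (#|[set P in t | S P Q]| <= 1)%N].

(** The dual operator. It is normalised by the mass of [P] and not of its shadow, as duality with
    respect to [m] requires; at [m P = 0] the convention [0^-1 = 0] gives [0]. *)
Definition average (g : I -> R) (P : I) : R :=
  (m P)^-1 * \sum_(Q | S P Q) g Q * m Q.

Let K0 : 0 < K. Proof. exact: lt_le_trans K1. Qed.

Lemma average_ge0 (g : I -> R) P : (forall Q, 0 <= g Q) -> 0 <= average g P.
Proof.
by move=> g0; rewrite mulr_ge0 ?invr_ge0// sumr_ge0// => Q _; rewrite mulr_ge0.
Qed.

(** When [m P = 0], [shadow_le] makes every mass in the shadow vanish, so the identity survives the
    division by zero. *)
Lemma mul_average (g : I -> R) P : m P * average g P = \sum_(Q | S P Q) g Q * m Q.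
Proof.
have [mP0|mP] := eqVneq (m P) 0; last by rewrite mulrA divff// mul1r.
rewrite mP0 mul0r big1// => Q SPQ.
have : \sum_(Q | S P Q) m Q = 0.
  apply/eqP; rewrite eq_le sumr_ge0// andbT.
  by have := shadow_le P; rewrite mP0 mulr0.
move=> /eqP; rewrite psumr_eq0// => /allP/(_ Q); rewrite mem_index_enum SPQ/=.
by move=> /(_ isT)/eqP ->; rewrite mulr0.
Qed.

Lemma average_le (g : I -> R) P b : 0 <= b -> (forall Q, g Q <= b) -> average g P <= K * b.
Proof.
move=> b0 gb; have [mP0|mP] := eqVneq (m P) 0.
  by rewrite /average mP0 invr0 mul0r mulr_ge0// ltW.
have mP1 : 0 < m P by rewrite lt_neqAle eq_sym mP m_ge0.
rewrite ler_pdivrMl//.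
apply: (@le_trans _ _ (\sum_(Q | S P Q) b * m Q)).
  by apply: ler_sum => Q _; rewrite ler_wpM2r.
rewrite -mulr_sumr; apply: (le_trans (ler_wpM2l b0 (shadow_le P))); nra.
Qed.

Lemma averageD (g h : I -> R) P : average (fun Q => g Q + h Q) P = average g P + average h P.
Proof.
by rewrite /average -mulrDr -big_split; congr (_ * _); apply: eq_bigr => Q _; rewrite mulrDl.
Qed.

(** Select from the level set by [covering]: the average exceeds [l] at each selected [P], and since
    no [Q] lies in two selected shadows, the shadow sums add up to at most the full sum of
    [g Q * m Q]. *)
Lemma average_weak_type (g : I -> R) (l : R) : 0 < l -> (forall Q, 0 <= g Q) ->
  l * \sum_(P | l < average g P) m P <= K * \sum_Q g Q * m Q.
Proof.
move=> l0 g0; have [t [tA st t1]] := covering (fun P => l < average g P).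
apply: (@le_trans _ _ (l * (K * \sum_(P in t) m P))); first by rewrite ler_pM2l.
rewrite mulrCA ler_pM2l// mulr_sumr.
apply: (@le_trans _ _ (\sum_(P in t) \sum_(Q | S P Q) g Q * m Q)).
  apply: ler_sum => P /tA lP; rewrite -mul_average mulrC ler_wpM2l//.
  exact: ltW.
rewrite (exchange_big_dep predT)//=; apply: ler_sum => Q _.
rewrite sumr_const -mulr_natr -[leRHS]mulr1 ler_wpM2l ?mulr_ge0// lern1.
apply: leq_trans (t1 Q); apply: eq_leq; apply: eq_card => P.
by rewrite !inE.
Qed.

(* Marcinkiewicz truncation: the part of [g] below [l / (2 K)] contributes at
   most [l / 2] to each average. *)
Lemma average_weak_type_trunc (g : I -> R) (l : R) : 0 < l -> (forall Q, 0 <= g Q) ->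
  l * \sum_(P | l < average g P) m P <=
  2 * K * \sum_(Q | l < 2 * K * g Q) g Q * m Q.
Proof.
move=> l0 g0.
pose g1 Q : R := if l < 2 * K * g Q then g Q else 0.
pose g2 Q : R := if l < 2 * K * g Q then 0 else g Q.
have gE : g = fun Q => g1 Q + g2 Q.
  by apply/funext => Q; rewrite /g1 /g2; case: ifP; rewrite ?addr0 ?add0r.
have g1_ge0 Q : 0 <= g1 Q by rewrite /g1; case: ifP.
have l2 : 0 < l / 2 by rewrite divr_gt0.
have := average_weak_type _ _ l2 g1_ge0.
have -> : \sum_Q g1 Q * m Q = \sum_(Q | l < 2 * K * g Q) g Q * m Q.
  by rewrite [RHS]big_mkcond; apply: eq_bigr => Q _; rewrite /g1; case: ifP; rewrite ?mul0r.
set X := \sum_(Q | _) _ => wt.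
have : \sum_(P | l < average g P) m P <= \sum_(P | l / 2 < average g1 P) m P.
  rewrite [leLHS]big_mkcond [leRHS]big_mkcond; apply: ler_sum => P _.
  case: ifPn => [lP|_]; last by case: ifP.
  suff -> : l / 2 < average g1 P by [].
  have : average g2 P <= K * (l / (2 * K)).
    apply: average_le => [|Q]; first by rewrite divr_ge0// ?mulr_ge0// ltW.
    rewrite /g2; case: (ltP l (2 * K * g Q)) => h; first by rewrite divr_ge0// ?mulr_ge0// ltW.
    by rewrite ler_pdivlMr ?mulr_gt0// mulrC.
  rewrite (_ : K * _ = l / 2); last by field; rewrite gt_eqF.
  have : average g P = average g1 P + average g2 P by rewrite {1}gE; exact: averageD.
  by move: lP; lra.
move=> h; have := le_trans (ler_wpM2l (ltW l2) h) wt.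
by rewrite mulrAC ler_pdivrMr// [leRHS]mulrC mulrA.
Qed.

(** The factor with base [2] comes from rounding up to the next dyadic level, the one with base
    [2 * K] from the truncation height, and the last one from the geometric series of exponent
    [q - 1]. *)
Definition strong_const (q : R) : R :=
  2 `^ q * (2 * K) `^ q * (1 - 2^-1 `^ (q - 1))^-1.

(** Marcinkiewicz interpolation with dyadic levels in place of an integral over heights: apply the
    truncated weak-type bound at each level [tau i], exchange the sums, and sum a geometric series
    for each [Q]. *)
Lemma average_strong_type (g : I -> R) (q : R) : 1 < q -> (forall Q, 0 <= g Q) ->
  \sum_P m P * average g P `^ q <= strong_const q * \sum_Q m Q * g Q `^ q.
Proof.
move=> q1 g0.
have q0 : 0 < q by exact: lt_trans q1.
pose x P := average g P.
have x0 P : 0 <= x P by exact: average_ge0.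
(* A bottom level below every nonzero average: [d^-1] exceeds each [(x P)^-1], and vanishing
   averages contribute [0] to the sum. *)
pose d := (1 + \sum_P (x P)^-1)^-1.
have sx0 : 0 <= \sum_P (x P)^-1 by apply: sumr_ge0 => P _; rewrite invr_ge0.
have d0 : 0 < d by rewrite invr_gt0; lra.
have dx P : 0 < x P -> d < x P.
  move=> xP; rewrite /d -[ltRHS]invrK ltf_pV2 ?posrE ?invr_gt0//; last lra.
  rewrite (bigD1 P)//=.
  have : 0 <= \sum_(i | i != P) (x i)^-1 by apply: sumr_ge0 => Q _; rewrite invr_ge0.
  lra.
have [k xk] : exists k, forall P, x P <= d * 2 ^+ k.
  exists (Num.bound (\sum_P x P / d)) => P.
  rewrite mulrC -ler_pdivrMr//.
  apply: (@le_trans _ _ (\sum_P x P / d)).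
    by rewrite (bigD1 P)//= lerDl sumr_ge0// => Q _; rewrite divr_ge0// ltW.
  apply: (le_trans (ltW (archi_boundP _))).
    by apply: sumr_ge0 => Q _; rewrite divr_ge0// ltW.
  by rewrite -natrX ler_nat ltnW// ltn_expl.
pose tau i := d * 2 ^+ i.
have tau0 i : 0 < tau i by rewrite mulr_gt0// exprn_gt0.
apply: (@le_trans _ _ (\sum_P m P * \sum_(i < k | tau i < x P) (2 * tau i) `^ q)).
  apply: ler_sum => P _; rewrite ler_wpM2l//.
  have := x0 P; rewrite le_eqVlt => /orP[/eqP xP|xP].
    by rewrite -/(x P) -xP powR0 ?gt_eqF// sumr_ge0// => i _; exact: powR_ge0.
  by apply: le_dyadic_sum; rewrite ?(ltW q0)// dx//=.
under eq_bigr do rewrite mulr_sumr.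
rewrite (exchange_big_dep predT)//=.
apply: (@le_trans _ _ (\sum_(i < k) 2 `^ q * tau i `^ (q - 1) *
   (2 * K * \sum_(Q | tau i < 2 * K * g Q) g Q * m Q))).
  apply: ler_sum => i _; rewrite -mulr_suml powRM ?(ltW (tau0 _))//.
  (* One factor [tau i] is split off from the power to meet the weak-type bound. *)
  rewrite -(mulr_powRB1 (ltW (tau0 i)) q0).
  have := average_weak_type_trunc _ _ (tau0 i) g0.
  move=> /(ler_wpM2l (mulr_ge0 (powR_ge0 2 q) (powR_ge0 (tau i) (q - 1)))) h.
  by apply: le_trans h; rewrite le_eqVlt; apply/orP; left; apply/eqP; ring.
under [leLHS]eq_bigr do rewrite !mulr_sumr.
rewrite (exchange_big_dep predT)//= mulr_sumr; apply: ler_sum => Q _.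
have y0 : 0 <= 2 * K * g Q by rewrite mulr_ge0// mulr_ge0// ltW.
have r0 : 0 < q - 1 by rewrite subr_gt0.
have := dyadic_sum_le _ _ _ _ k r0 d0 y0; rewrite -/(tau _) => h.
rewrite [leLHS](_ : _ = 2 `^ q * (2 * K * g Q) * m Q *
    \sum_(i < k | tau i < 2 * K * g Q) tau i `^ (q - 1)); last first.
  by rewrite mulr_sumr; apply: eq_bigr => i _; ring.
apply: (le_trans (ler_wpM2l _ h)); first by rewrite !mulr_ge0 ?powR_ge0// ltW.
rewrite le_eqVlt; apply/orP; left; apply/eqP; rewrite /strong_const.
transitivity (2 `^ q * m Q * (1 - 2^-1 `^ (q - 1))^-1 *
   ((2 * K * g Q) * (2 * K * g Q) `^ (q - 1))); first by ring.
rewrite mulr_powRB1// powRM// ?mulr_ge0// ?ltW//; ring.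
Qed.

Lemma strong_const_gt0 q : 1 < q -> 0 < strong_const q.
Proof.
move=> q1; rewrite /strong_const !mulr_gt0 ?powR_gt0 ?mulr_gt0// invr_gt0 subr_gt0.
rewrite -[ltRHS](_ : 1 `^ (q - 1) = 1); last by rewrite powR1.
by apply: gt0_ltr_powR; rewrite ?nnegrE//; lra.
Qed.

(** For [p = 1] there is no finite conjugate exponent, and the bound on shadow masses suffices by
    itself. For [p > 1], [p / (p - 1)] is the conjugate exponent, and the outer factor [2] comes
    from absorbing half of the left side in [shadow_sum_le]. *)
Definition shadow_const (p : R) : R :=
  if p == 1 then K else 2 * (2 * strong_const (p / (p - 1))) `^ (p - 1).

Lemma shadow_const_gt0 p : 1 <= p -> 0 < shadow_const p.
Proof.
rewrite /shadow_const le_eqVlt eq_sym; case: eqP => [//|_ /= p1].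
rewrite mulr_gt0// powR_gt0// mulr_gt0// strong_const_gt0//.
by rewrite ltr_pdivlMr ?subr_gt0//; lra.
Qed.

(* For [p > 1], the operator [a |-> \sum_(P | S P Q) a P] is dual to [average]. *)
Lemma shadow_sum_le (p : R) (a : I -> R) : 1 <= p -> (forall P, 0 <= a P) ->
  \sum_Q m Q * (\sum_(P | S P Q) a P) `^ p <=
  shadow_const p * \sum_P m P * a P `^ p.
Proof.
move=> + a0; pose G Q := \sum_(P | S P Q) a P.
have G0 Q : 0 <= G Q by exact: sumr_ge0.
(* Duality: both sides are the sum of [a P * g Q * m Q] over all pairs with [S P Q]. *)
have swap (g : I -> R) :
    \sum_Q m Q * (g Q * G Q) = \sum_P a P * (m P * average g P).
  under [RHS]eq_bigr do rewrite mul_average mulr_sumr.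
  rewrite [RHS](exchange_big_dep predT)//=; apply: eq_bigr => Q _.
  by rewrite !mulr_sumr; apply: eq_bigr => P _; ring.
rewrite /shadow_const le_eqVlt eq_sym; case: eqP => [-> _|_ /= p1].
  rewrite [leLHS](_ : _ = \sum_Q m Q * (1 * G Q)); last first.
    by apply: eq_bigr => Q _; rewrite powRr1 ?mul1r//; exact: G0.
  rewrite (swap (fun=> 1)) mulr_sumr; apply: ler_sum => P _.
  rewrite powRr1// mul_average [leRHS]mulrA [leRHS]mulrC ler_wpM2l//.
  by under eq_bigr do rewrite mul1r; exact: shadow_le.
have p0 : 0 < p by lra.
have pn : p != 0 by rewrite gt_eqF.
have p1n : p - 1 != 0 by rewrite gt_eqF// subr_gt0.
set q := p / (p - 1).
have q1 : 1 < q by rewrite ltr_pdivlMr ?subr_gt0//; lra.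
have q0 : 0 < q by lra.
have c0 := strong_const_gt0 _ q1; set c := strong_const q in c0 *.
(* The extremal test function: both its [q]-th power and its product with [G] are the [p]-th power
   of [G]. *)
pose g Q := G Q `^ (p - 1).
have g0 Q : 0 <= g Q by exact: powR_ge0.
have gq Q : g Q `^ q = G Q `^ p by rewrite /g -powRrM /q mulrCA divff ?mulr1// gt_eqF// subr_gt0.
have := average_strong_type _ _ q1 g0; rewrite -/c.
under [X in _ <= _ * X]eq_bigr do rewrite gq.
set X := \sum_Q m Q * G Q `^ p; set Y := \sum_P _ => YX.
set A := \sum_P m P * a P `^ p.
(* The weight for Young's inequality applied to [(e^-1 * a P) * (e * average g P)]: the [q]-th power
   of [e] is [(2 * c)^-1], so the strong-type bound makes the second term at most [X / 2], which is
   absorbed on the left. *)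
pose e := (2 * c)^-1 `^ q^-1.
have e0 : 0 < e by rewrite powR_gt0// invr_gt0 mulr_gt0.
have eqE : e `^ q = (2 * c)^-1.
  by rewrite /e -powRrM mulVf ?gt_eqF// powRr1// invr_ge0 mulr_ge0// ltW.
have c2 : 0 <= 2 * c by apply: mulr_ge0 => //; exact: ltW.
have epE : e^-1 `^ p = (2 * c) `^ (p - 1).
  rewrite /e -powR_inv1 ?powR_ge0// -powR_inv1 ?c2//.
  rewrite -!powRrM; congr (_ `^ _); rewrite /q; field.
  by rewrite p1n pn.
have A0 : 0 <= A by apply: sumr_ge0 => P _; rewrite mulr_ge0// powR_ge0.
have X0 : 0 <= X by apply: sumr_ge0 => P _; rewrite mulr_ge0// powR_ge0.
have : X <= (2 * c) `^ (p - 1) * A + (2 * c)^-1 * Y.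
  have -> : X = \sum_Q m Q * (g Q * G Q).
    by apply: eq_bigr => Q _; rewrite -(mulr_powRB1 (G0 Q) p0) [G Q * _]mulrC.
  rewrite swap -epE -eqE /A /Y !mulr_sumr -big_split/=; apply: ler_sum => P _.
  have Av0 := average_ge0 _ P g0.
  have ea0 : 0 <= e^-1 * a P by rewrite mulr_ge0// invr_ge0 ltW.
  have eA0 : 0 <= e * average g P by rewrite mulr_ge0// ltW.
  have pq : p^-1 + q^-1 = 1 by rewrite /q; field; rewrite p1n pn.
  have := conjugate_powR ea0 eA0 p0 q0 pq.
  rewrite [X in X <= _](_ : _ = a P * average g P); last by field; rewrite gt_eqF.
  rewrite (powRM _ _ (a0 P)) ?invr_ge0 ?(ltW e0)// (powRM _ (ltW e0) Av0) => Y1.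
  have -> : a P * (m P * average g P) = m P * (a P * average g P) by ring.
  rewrite [leRHS](_ : _ = m P * (e^-1 `^ p * a P `^ p + e `^ q * average g P `^ q)).
    rewrite ler_wpM2l//; apply: (le_trans Y1).
    by rewrite lerD// ler_piMr ?mulr_ge0 ?powR_ge0// invf_le1//; lra.
  by ring.
have : (2 * c)^-1 * Y <= 2^-1 * X.
  apply: (le_trans (ler_wpM2l _ YX)); first by rewrite invr_ge0 mulr_ge0// ltW.
  by rewrite le_eqVlt; apply/orP; left; apply/eqP; field; rewrite gt_eqF.
rewrite -mulrA; lra.
Qed.

End averages.

(** * Cubes and Whitney cubes *)

Section cube_geometry.
Context {R : realType} {n : nat}.
Implicit Types P Q : cube R n.

Lemma cube_center Q : 0 < Q.2 -> cube_set Q Q.1.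
Proof. by move=> Q0 i; lra. Qed.

Lemma cube_set_sub P Q : (forall i, `|P.1 ord0 i - Q.1 ord0 i| + P.2 <= Q.2) ->
  cube_set P `<=` cube_set Q.
Proof.
move=> h x Px i; have := Px i; have := h i.
rewrite -lerBrDr ler_norml; lra.
Qed.

Lemma cube_sub_dilate (t : R) Q : 0 <= Q.2 -> 1 <= t ->
  cube_set Q `<=` cube_set (dilate t Q).
Proof.
move=> Q0 t1; apply: cube_set_sub => i /=.
by rewrite subrr normr0 add0r -[leLHS]mul1r ler_wpM2r.
Qed.

Lemma meeting_cubes_dist P Q z : cube_set P z -> cube_set Q z ->
  forall i, `|P.1 ord0 i - Q.1 ord0 i| <= P.2 + Q.2.
Proof. by move=> Pz Qz i; have := Pz i; have := Qz i; rewrite ler_norml; lra. Qed.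

(** The centres differ by at most [P.2 + Q.2] in each coordinate, so [P] stays within
    [2 * P.2 + Q.2 <= 3 * Q.2] of the centre of [Q]. *)
Lemma meeting_cube_sub P Q z : cube_set P z -> cube_set Q z -> P.2 <= Q.2 ->
  cube_set P `<=` cube_set (dilate 3 Q).
Proof.
move=> Pz Qz PQ; apply: cube_set_sub => i /=.
have := meeting_cubes_dist _ _ _ Pz Qz i; lra.
Qed.

(** Greedy selection by induction on the cardinal of [A]: keep a largest cube, discard every cube
    meeting it, which its triple contains, and select among the rest. *)
Lemma vitali_cubes (I : finType) (q : I -> cube R n) (A : {set I}) :
  (forall i, 0 < (q i).2) ->
  exists t : {set I}, [/\ t \subset A,
    forall i j, i \in t -> j \in t -> cube_set (q i) `&` cube_set (q j) !=set0 -> i = j &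
    forall i, i \in A -> exists2 j, j \in t & cube_set (q i) `<=` cube_set (dilate 3 (q j))].
Proof.
move=> q0; have [k] := ubnP #|A|; elim: k A => // k IH A; rewrite ltnS => Ak.
have [->|[i0 i0A]] := set_0Vmem A.
  by exists finset.set0; split=> [|i j|i]; rewrite ?sub0set ?inE.
case: (@arg_maxP _ _ _ i0 (mem A) (fun i => (q i).2) i0A) => /= P PA Pmax.
pose meets j := `[< cube_set (q j) `&` cube_set (q P) !=set0 >].
have PP : meets P by apply/asboolP; exists (q P).1; split; exact: cube_center.
have [|t [tB tdisj tcov]] := IH [set j in A | ~~ meets j]%SET.
  apply: leq_trans Ak; apply: proper_card; apply/properP; split.
    by apply/fintype.subsetP => j; rewrite inE => /andP[].
  exists P; [exact: PA|by rewrite inE PP andbF].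
have tm j : j \in t -> j \in A /\ ~~ meets j.
  by move=> /(fintype.subsetP tB); rewrite inE => /andP[].
exists (P |: t)%SET; split.
- by apply/fintype.subsetP => j /setU1P[->|/tm[]].
- move=> i j /setU1P[->|it] /setU1P[->|jt] //.
  + by rewrite setIC => h; have [_ /asboolP] := tm _ jt.
  + by move=> h; have [_ /asboolP] := tm _ it.
  + exact: tdisj.
- move=> i iA; case: (boolP (meets i)) => [/asboolP[z [zi zP]]|mi].
    exists P; first exact: setU11.
    by apply: meeting_cube_sub zi zP _; exact: Pmax.
  have [|j jt ij] := tcov i; first by rewrite inE iA.
  by exists j => //; rewrite !inE jt orbT.
Qed.

(** Local integrability is stated on compact sets, and half-open cubes are in general not
    compact. *)
Definition closed_cube Q : set 'rV[R]_n :=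
  [set x | forall i, Q.1 ord0 i - Q.2 <= x ord0 i <= Q.1 ord0 i + Q.2].

Lemma compact_closed_cube Q : compact (closed_cube Q).
Proof.
have := @rV_compact R n (fun i => `[Q.1 ord0 i - Q.2, Q.1 ord0 i + Q.2]%classic).
move=> /(_ (fun i => @segment_compact _ _ _)).
by congr compact; apply/seteqP; split => x h i; have := h i; rewrite /= in_itv.
Qed.

Lemma cube_sub_closed Q : cube_set Q `<=` closed_cube Q.
Proof. by move=> x Qx i; have := Qx i; lra. Qed.

Lemma dyadic_gt0 Q : dyadic Q -> 0 < Q.2.
Proof.
move=> [k [_ [sQ _]]]; have : (0 : R) < 2 ^ k by exact: exprz_gt0.
by rewrite -sQ /side; lra.
Qed.

Lemma countable_dyadic (W : set (cube R n)) : (forall Q, W Q -> dyadic Q) ->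
  countable W.
Proof.
move=> Wd.
pose f (km : int * {ffun 'I_n -> int}) : cube R n :=
  (\row_i ((km.2 i)%:~R * 2 ^ km.1 + 2 ^ km.1 / 2), 2 ^ km.1 / 2).
apply: (@sub_countable _ _ _ [set: int * {ffun 'I_n -> int}]); last exact: countableP.
apply: card_le_trans (card_image_le f _).
apply: subset_card_le => -[x r] /Wd[k [m [sQ mQ]]].
exists (k, finfun m) => //; have rE : 2 ^ k / 2 = r by rewrite -sQ /side/=; field.
rewrite /f /= rE; congr pair; apply/rowP => i; rewrite mxE ffunE -mQ/=; lra.
Qed.

End cube_geometry.

Section whitney_geometry.
Context {R : realType} {n : nat} (n0 : (0 < n)%N).
Variables (Omega : set 'rV[R]_n) (W : set (cube R n)).
Hypothesis WO : whitney Omega W.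

Lemma whitney_gt0 Q : W Q -> 0 < Q.2.
Proof. by case: WO => Wd _ _ _ /Wd; exact: dyadic_gt0. Qed.

Lemma whitney_sub Q : W Q -> cube_set Q `<=` Omega.
Proof. by case: WO => _ _ <- _ WQ x Qx; exists Q. Qed.

Lemma edist_center_le (x y : 'rV[R]_n) (r : R) : 0 <= r ->
  (forall i, `|x ord0 i - y ord0 i| <= r) -> Defs.edist x y <= Num.sqrt n%:R * r.
Proof.
move=> r0 h; rewrite -[X in _ * X]ger0_norm// -sqrtr_sqr -sqrtrM ?ler0n// ler_wsqrtr//.
rewrite -[n in n%:R]card_ord mulr_natl -sumr_const; apply: ler_sum => i _.
by rewrite -[leLHS]real_normK ?num_real// ler_sqr ?nnegrE.
Qed.

(** A point outside [Omega] would be at Euclidean distance at most [9 / 8 * sqrt n * Q.2] from the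
    centre of [Q], less than the Whitney lower bound [2 * sqrt n * Q.2]. Strictness uses [n > 0]. *)
Lemma whitney_star_sub Q : W Q -> closed_cube (star Q) `<=` Omega.
Proof.
move=> WQ x xQ; apply: contrapT => nOx.
have Q0 := whitney_gt0 _ WQ.
have [_ _ _ /(_ _ WQ)/andP[+ _]] := WO.
apply/negP; rewrite -ltNge.
apply: (@le_lt_trans _ _ (Defs.edist Q.1 x)).
  apply: ge_inf; last by exists Q.1; [exact: cube_center|exists x].
  by exists 0 => _ [a _ [b _ <-]]; exact: sqrtr_ge0.
apply: (@le_lt_trans _ _ (Num.sqrt n%:R * (9 / 8 * Q.2))).
  apply: edist_center_le => [|i]; first lra.
  by have := xQ i; rewrite /star/= ler_norml; lra.
by rewrite /side ltr_pM2l ?sqrtr_gt0 ?ltr0n//; lra.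
Qed.

End whitney_geometry.

(** * Weighted deviations *)

Lemma powRD_le (R : realType) (p x y : R) : 0 <= p -> 0 <= x -> 0 <= y ->
  (x + y) `^ p <= 2 `^ p * (x `^ p + y `^ p).
Proof.
move=> p0; wlog xy : x y / x <= y.
  move=> h x0 y0; case: (leP x y) => [|/ltW] xy; first exact: h.
  by rewrite addrC [X in _ * X]addrC; exact: h.
move=> x0 y0; apply: (@le_trans _ _ ((2 * y) `^ p)).
  by apply: ge0_ler_powR; rewrite ?nnegrE ?addr_ge0 ?mulr_ge0//; lra.
by rewrite powRM// ler_wpM2l ?powR_ge0// lerDr powR_ge0.
Qed.

(** A pointwise substitute for Hoelder's inequality with a free parameter [a]: for [x > a], write
    [x] as the product of its powers with exponents [1 - p] and [p], and use [1 - p <= 0]. *)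
Lemma le_affine_powR (R : realType) (p a x : R) : 1 <= p -> 0 < a -> 0 <= x ->
  x <= a + a `^ (1 - p) * x `^ p.
Proof.
move=> p1 a0 x0; case: (leP x a) => xa.
  by rewrite (le_trans xa)// lerDl mulr_ge0 ?powR_ge0.
have xp : 0 < x by exact: lt_trans xa.
apply: (@le_trans _ _ (a `^ (1 - p) * x `^ p)); last by rewrite lerDr ltW.
rewrite -(@mulr_powRB1 _ x p) ?(lt_le_trans _ p1)// mulrCA -[leLHS]mulr1 ler_wpM2l//.
rewrite -opprB powRN ler_pdivlMl ?powR_gt0// mulr1.
by apply: ge0_ler_powR; rewrite ?nnegrE ?subr_ge0// ltW.
Qed.

Section weighted_integrals.
Context d (T : measurableType d) (R : realType) (mu : {measure set T -> \bar R}).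
Variables (E : set T) (mE : measurable E).

Lemma ge0_integral_lin (f g : T -> R) (a b : R) :
  measurable_fun E f -> measurable_fun E g ->
  (forall x, E x -> 0 <= f x) -> (forall x, E x -> 0 <= g x) -> 0 <= a -> 0 <= b ->
  (\int[mu]_(x in E) (a * f x + b * g x)%:E =
   a%:E * \int[mu]_(x in E) (f x)%:E + b%:E * \int[mu]_(x in E) (g x)%:E)%E.
Proof.
move=> mf mg f0 g0 a0 b0; under eq_integral do rewrite EFinD.
have mZ (h : T -> R) c : measurable_fun E h -> measurable_fun E (fun x => (c * h x)%:E : \bar R).
  by move=> mh; apply/measurable_EFinP; exact: measurable_funM.
rewrite ge0_integralD//; last 4 first.
- by move=> x Ex; rewrite lee_fin mulr_ge0// f0.
- exact: mZ.
- by move=> x Ex; rewrite lee_fin mulr_ge0// g0.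
- exact: mZ.
under eq_integral do rewrite EFinM.
under [X in (_ + X)%E]eq_integral do rewrite EFinM.
by rewrite !ge0_integralZl_EFin//; exact/measurable_EFinP.
Qed.

Variables (w u : T -> R).
Hypothesis w0 : forall x, 0 <= w x.
Hypothesis mw : measurable_fun E w.
Hypothesis mu_ : measurable_fun E u.
Variable p : R.

Definition deviation (b : R) (A : set T) : \bar R :=
  (\int[mu]_(x in A) (`|u x - b| `^ p * w x)%:E)%E.

Lemma deviation_ge0 b A : (0 <= deviation b A)%E.
Proof. by apply: integral_ge0 => x _; rewrite lee_fin mulr_ge0// powR_ge0. Qed.

Lemma measurable_dev b : measurable_fun E (fun x => `|u x - b| `^ p * w x).
Proof.
apply: measurable_funM => //.
apply: (measurableT_comp (measurable_powR _)) => //.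
by apply: measurableT_comp => //; exact: measurable_funB.
Qed.

Let dev0 b x : E x -> 0 <= `|u x - b| `^ p * w x.
Proof. by rewrite mulr_ge0 ?powR_ge0. Qed.

Lemma deviation_shift (b b' : R) : 0 <= p ->
  (deviation b' E <= (2 `^ p)%:E * deviation b E +
     (2 `^ p * `|b - b'| `^ p)%:E * \int[mu]_(x in E) (w x)%:E)%E.
Proof.
move=> p0; rewrite /deviation -ge0_integral_lin ?mulr_ge0 ?powR_ge0//;
  [|exact: measurable_dev|exact: dev0].
apply: ge0_le_integral => //.
- by move=> x Ex; rewrite lee_fin dev0.
- exact/measurable_EFinP/measurable_dev.
- apply/measurable_EFinP; apply: measurable_funD; apply: measurable_funM => //.
  exact: measurable_dev.
move=> x Ex; rewrite lee_fin mulrA -mulrDl ler_wpM2r//.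
rewrite -mulrDr; apply: le_trans (powRD_le _ _ _ _ p0 _ _) => //.
apply: ge0_ler_powR; rewrite ?nnegrE ?addr_ge0//.
exact: ler_distD.
Qed.

(** Integrate [|b - b'| <= |u - b| + |u - b'|] after applying [le_affine_powR] with the parameters
    [al] and [be]; the exponents [1 - p] and [p] then add up to [1]. In the application [A] and [B]
    are the masses of two linked Whitney cubes. *)
Lemma constants_dist_le (b b' al be A B : R) : 1 <= p -> 0 < al -> 0 < be ->
  (deviation b E <= (al `^ p * A)%:E)%E ->
  (deviation b' E <= (be `^ p * B)%:E)%E ->
  (`|b - b'|%:E * \int[mu]_(x in E) (w x)%:E <=
   (al + be)%:E * \int[mu]_(x in E) (w x)%:E + (al * A + be * B)%:E)%E.
Proof.
move=> p1 al0 be0 hA hB.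
have p0 : 0 < p by lra.
have nu0 : (0 <= \int[mu]_(x in E) (w x)%:E)%E.
  by apply: integral_ge0 => x _; rewrite lee_fin.
have mD c := measurable_dev c.
pose f x := al `^ (1 - p) * (`|u x - b| `^ p * w x) +
            be `^ (1 - p) * (`|u x - b'| `^ p * w x).
have mf : measurable_fun E f.
  by apply: measurable_funD; apply: measurable_funM.
have f0 x : E x -> 0 <= f x.
  by move=> Ex; rewrite addr_ge0// mulr_ge0 ?powR_ge0// dev0.
have key (c r C : R) : 0 < r -> (deviation c E <= (r `^ p * C)%:E)%E ->
    ((r `^ (1 - p))%:E * deviation c E <= (r * C)%:E)%E.
  move=> r0 h; apply: (le_trans (lee_wpmul2l _ h)); first by rewrite lee_fin powR_ge0.
  rewrite -EFinM mulrA -powRD ?subrK ?powRr1 ?(ltW r0)//.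
  by rewrite (gt_eqF r0) implybT.
apply: (@le_trans _ _ (\int[mu]_(x in E) ((al + be) * w x + 1 * f x)%:E)%E); last first.
  rewrite ge0_integral_lin//; last by rewrite addr_ge0// ltW.
  rewrite leeD2l// mul1e ge0_integral_lin ?powR_ge0//; [|exact: dev0|exact: dev0].
  by rewrite EFinD leeD// key.
rewrite -ge0_integralZl_EFin//; [|by move=> x _; rewrite lee_fin|exact/measurable_EFinP].
apply: ge0_le_integral => //.
- by move=> x Ex; rewrite mule_ge0// lee_fin.
- by apply: measurable_funeM; exact/measurable_EFinP.
- apply/measurable_EFinP; apply: measurable_funD; exact: measurable_funM.
move=> x Ex; rewrite -EFinM lee_fin mul1r.
have -> : (al + be) * w x + f x = ((al + al `^ (1 - p) * `|u x - b| `^ p) +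
   (be + be `^ (1 - p) * `|u x - b'| `^ p)) * w x by rewrite /f; ring.
rewrite ler_wpM2r//; apply: (@le_trans _ _ (`|u x - b| + `|u x - b'|)).
  by rewrite [`|u x - b|]distrC; exact: ler_distD.
by rewrite lerD// le_affine_powR.
Qed.

End weighted_integrals.

Arguments deviation {d T R} mu w u p b A.

(** * Lebesgue integration over cubes and Whitney families *)

Section lebesgue_cubes.
Context {R : realType} {n : nat}.
Local Notation T := (@lebesgue_space R n).
Local Notation mu := (@lebesgue_rV R n).

Lemma measurable_itvs (J : 'I_n -> interval R) :
  measurable ([set x : 'rV[R]_n | forall i, x ord0 i \in J i] : set T).
Proof.
apply: sub_caratheodory; apply: sub_sigma_algebra.
have -> : [set x : 'rV[R]_n | forall i, x ord0 i \in J i] =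
  \bigcap_(i in [set: 'I_n]) [set x : 'rV[measurableTypeR R]_n | x ord0 i \in J i].
  by apply/seteqP; split=> x /= h i => [_|]; exact: h.
apply: fin_bigcap_measurable => // i _; rewrite -[X in measurable X]setTI.
exact: (@measurable_coord _ (measurableTypeR R) n i measurableT _ (measurable_itv (J i))).
Qed.

Lemma measurable_cube (Q : cube R n) : measurable (cube_set Q : set T).
Proof.
have := measurable_itvs (fun i => `[Q.1 ord0 i - Q.2, Q.1 ord0 i + Q.2[).
by congr measurable; apply/seteqP; split=> x h i; have := h i; rewrite in_itv.
Qed.

Lemma measurable_closed_cube (Q : cube R n) : measurable (closed_cube Q : set T).
Proof.
have := measurable_itvs (fun i => `[Q.1 ord0 i - Q.2, Q.1 ord0 i + Q.2]).
by congr measurable; apply/seteqP; split=> x h i; have := h i; rewrite in_itv.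
Qed.

Lemma lebesgue_cube_gt0 (Q : cube R n) : 0 < Q.2 -> (0 < mu (cube_set Q))%E.
Proof.
move=> Q0.
have -> : cube_set Q = box (\row_i (Q.1 ord0 i - Q.2)) (\row_i (Q.1 ord0 i + Q.2)).
  by apply/seteqP; split=> x h i; have := h i; rewrite !mxE.
rewrite lebesgue_rV_box; last by move=> i; rewrite !mxE; lra.
rewrite lte_fin; apply: prodr_gt0 => i _; rewrite !mxE; lra.
Qed.

(** A zero integral would force [w = 0] almost everywhere on the cube and make the cube negligible,
    although its volume is positive. *)
Lemma integral_gt0_cube (w : T -> R) (Q : cube R n) : 0 < Q.2 ->
  (forall x, 0 < w x) -> measurable_fun (cube_set Q : set T) w ->
  (0 < wmeas w (cube_set Q))%E.
Proof.
move=> Q0 w0 mw; rewrite lt_neqAle; apply/andP; split; last first.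
  by apply: integral_ge0 => x _; rewrite lee_fin ltW.
apply/eqP => wQ0.
have := lebesgue_cube_gt0 _ Q0; apply/negP; rewrite -leNgt.
have : ae_eq mu (cube_set Q : set T) (EFin \o w) (cst 0%E).
  apply/(ae_eq_integral_abs mu (measurable_cube Q)); first exact/measurable_EFinP.
  rewrite [RHS]wQ0; apply: eq_integral => x _.
  by rewrite gee0_abs ?lee_fin ?ltW//.
move=> [N [mN N0 subN]]; rewrite -N0; apply: le_measure; rewrite ?inE//.
  exact: measurable_cube.
move=> x Qx; apply: subN => /= /(_ Qx) /eqP; rewrite eqe.
by rewrite gt_eqF.
Qed.

End lebesgue_cubes.

Lemma countable_enumeration (T : choiceType) (W : set T) : countable W ->
  exists G : nat -> option T, [/\ forall k Q, G k = Some Q -> W Q,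
    forall Q, W Q -> exists k, G k = Some Q &
    forall i j Q, G i = Some Q -> G j = Some Q -> i = j].
Proof.
move=> /countable_injP[f] finj.
pose G k := if pselect (exists Q, W Q /\ f Q = k) is left h
            then Some (projT1 (cid h)) else None.
have GE k Q : G k = Some Q -> W Q /\ f Q = k.
  by rewrite /G; case: pselect => // h [<-]; exact: (projT2 (cid h)).
exists G; split=> [k Q /GE[]//|Q WQ|i j Q /GE[_ <-] /GE[_ <-]//].
exists (f Q); rewrite /G; case: pselect => [h|[]]; last by exists Q.
have [WP fP] := projT2 (cid h); congr Some.
by apply: finj; rewrite ?inE.
Qed.

Section whitney_measure.
Context {R : realType} {n : nat}.
Local Notation T := (@lebesgue_space R n).
Local Notation mu := (@lebesgue_rV R n).
Variables (Omega : set 'rV[R]_n) (W : set (cube R n)).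
Hypothesis WO : whitney Omega W.

Lemma whitney_enumeration : exists G : nat -> option (cube R n),
  let F k := oapp cube_set set0 (G k) in
  [/\ forall k Q, G k = Some Q -> W Q,
    forall i j Q, G i = Some Q -> G j = Some Q -> i = j,
    \bigcup_k F k = Omega & trivIset setT F].
Proof.
have [Wd Wt WU _] := WO.
have [G [GW WG Ginj]] := countable_enumeration _ _ (countable_dyadic _ Wd).
exists G; split=> //.
  rewrite -WU; apply/seteqP; split=> [x [k _]|x [Q WQ Qx]].
    by case E: (G k) => [Q|]//= Qx; exists Q => //; exact: GW E.
  by have [k kQ] := WG _ WQ; exists k => //; rewrite kQ.
move=> i j _ _ [x []].
case Ei: (G i) => [P|]//= Px; case Ej: (G j) => [Q|]//= Qx.
have PQ : P = Q by apply: Wt; [exact: GW Ei|exact: GW Ej|exists x].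
by apply: Ginj Ei _; rewrite PQ.
Qed.

Let mF (G : nat -> option (cube R n)) k :
  measurable (oapp cube_set set0 (G k) : set T).
Proof. by case: (G k) => [Q|]//=; exact: measurable_cube. Qed.

Lemma whitney_measurable : measurable (Omega : set T).
Proof.
have [G [_ _ <- _]] := whitney_enumeration.
by apply: bigcup_measurable => k _; exact: mF.
Qed.

Lemma whitney_measurable_fun (f : T -> R) :
  (forall Q, W Q -> measurable_fun (cube_set Q : set T) f) ->
  measurable_fun (Omega : set T) f.
Proof.
move=> mf; have [G [GW _ <- _]] := whitney_enumeration.
apply/measurable_fun_bigcup => [k|k]; first exact: mF.
case E: (G k) => [Q|]/=; last exact: measurable_fun_set0.
by apply: mf; exact: GW E.
Qed.

(** By countable additivity the integral over [Omega] is a limit of sums over finitely many Whitney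
    cubes. This is what allows the shadow estimates to be proved for finite index sets only. *)
Lemma whitney_integral_le (g : T -> R) (B : \bar R) :
  (forall x, 0 <= g x) -> measurable_fun (Omega : set T) g ->
  (forall s : seq (cube R n), uniq s -> (forall Q, Q \in s -> W Q) ->
     \sum_(Q <- s) \int[mu]_(x in cube_set Q) (g x)%:E <= B)%E ->
  (\int[mu]_(x in Omega) (g x)%:E <= B)%E.
Proof.
move=> g0 mg gB; have [G [GW Ginj U tF]] := whitney_enumeration.
rewrite -U (@ge0_integral_bigcup _ T R mu _ (EFin \o g)); first last.
- exact: tF.
- by move=> x _; rewrite /= lee_fin.
- by rewrite U; exact/measurable_EFinP.
- exact: mF.
apply: lime_le.
  by apply: is_cvg_nneseries => k _ _; apply: integral_ge0 => x _; rewrite lee_fin.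
apply: nearW => m; rewrite big_mkord.
have -> : (\sum_(k < m) \int[mu]_(x in oapp cube_set set0 (G k)) (g x)%:E =
  \sum_(Q <- pmap G (iota 0 m)) \int[mu]_(x in cube_set Q) (g x)%:E)%E.
  rewrite -(big_mkord xpredT (fun k => \int[mu]_(x in oapp cube_set set0 (G k)) (g x)%:E))%E.
  rewrite /index_iota subn0; elim: (iota 0 m) => [|k s IH]; first by rewrite !big_nil.
  rewrite big_cons IH /=; case: (G k) => [Q|]/=; first by rewrite big_cons.
  by rewrite integral_set0 add0e.
apply: gB => [|Q]; last first.
  by rewrite mem_pmap => /mapP[k _ kQ]; exact: GW (esym kQ).
elim: (iota 0 m) (iota_uniq 0 m) => //= k s IH /andP[ks /IH us].
case E: (G k) => [Q|]//=; rewrite us andbT mem_pmap.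
apply/negP => /mapP[j js jQ]; move: ks; rewrite (_ : k = j) ?js//.
exact: Ginj E (esym jQ).
Qed.

End whitney_measure.

(** * Doubling weights and chains *)

(** Each cube of the chain takes part in at most two links, whence the factor [2]. *)
Lemma telescope_le (R : realDomainType) (T : Type) (a b : T -> R) (L : R)
    (x0 : T) (s : seq T) : 0 <= L -> (forall P, 0 <= a P) ->
  (forall j, (0 < j < size s)%N ->
     `|b (nth x0 s j.-1) - b (nth x0 s j)| <= L * (a (nth x0 s j.-1) + a (nth x0 s j))) ->
  `|b (last x0 s) - b (head x0 s)| <= 2 * L * \sum_(P <- s) a P.
Proof.
move=> L0 a0; case: s => [_|x s]; first by rewrite subrr normr0 big_nil mulr0.
rewrite big_cons /=.
(* Strengthened for the induction: the first cube has no link before it and is counted once. *)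
suff : (forall j, (j < size s)%N ->
     `|b (nth x0 (x :: s) j) - b (nth x0 s j)| <= L * (a (nth x0 (x :: s) j) + a (nth x0 s j))) ->
   `|b (last x s) - b x| <= L * (a x + 2 * \sum_(P <- s) a P).
  move=> h h'; apply: (le_trans (h _)) => [j js|]; first exact: (h' j.+1).
  by rewrite [2 * L]mulrC -mulrA ler_wpM2l//; have := a0 x; lra.
elim: s x => [|y s IH] x h; first by rewrite subrr normr0 big_nil mulr0 addr0 mulr_ge0.
rewrite big_cons /=.
have hxy := h 0%N isT; have := IH y (fun j => h j.+1).
move: hxy => /=; set S := \sum_(_ <- _) _ => h1 h2.
rewrite (le_trans (ler_distD (b y) _ _))//.
rewrite [`|b y - b x|]distrC (le_trans (lerD h2 h1))//; lra.
Qed.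

(** Lets [h] tend to [0]: the parameters of [constants_dist_le] must be positive, while the
    coefficients [x] and [y] may vanish. *)
Lemma le_of_approx (R : realFieldType) (K x y d mS mP mQ : R) :
  0 <= K -> 0 <= x -> 0 <= y -> 0 < mS -> mP <= K * mS -> mQ <= K * mS ->
  (forall h, 0 < h ->
    d * mS <= (x + h + (y + h)) * mS + ((x + h) * mP + (y + h) * mQ)) ->
  d <= (1 + K) * (x + y).
Proof.
move=> K0 x0 y0 mS0 mPK mQK H; apply/ler_addgt0Pr => e e0.
have K1 : 0 < 1 + K by lra.
pose h := e / (2 * (1 + K)).
have h0 : 0 < h by rewrite divr_gt0// mulr_gt0.
have xh : 0 <= x + h by lra.
have yh : 0 <= y + h by lra.
rewrite -(ler_pM2r mS0); apply: (le_trans (H _ h0)).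
apply: (le_trans (lerD (lexx _) (lerD (ler_wpM2l xh mPK) (ler_wpM2l yh mQK)))).
rewrite le_eqVlt; apply/orP; left; apply/eqP.
have -> : e = 2 * (1 + K) * h by rewrite /h; field; rewrite gt_eqF.
ring.
Qed.

Lemma big_mem_uniq (V : nmodType) (I : eqType) (r s : seq I) (F : I -> V) :
  uniq r -> uniq s -> {subset s <= r} ->
  \sum_(i <- r | i \in s) F i = \sum_(i <- s) F i.
Proof.
move=> ur us sr; rewrite -big_filter; apply: perm_big; apply: uniq_perm => //.
  exact: filter_uniq.
by move=> i; rewrite mem_filter; case: (boolP (i \in s)) => // /sr ->.
Qed.

Lemma sum_le_esum (R : realType) (I : choiceType) (W : set I) (F : I -> \bar R) (s : seq I) :
  uniq s -> (forall i, i \in s -> W i) ->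
  (\sum_(i <- s) F i <= \esum_(i in W) F i)%E.
Proof.
move=> us sW; apply: esum_ge; exists [set` s].
  by split; [exact: finite_seq|move=> i /sW].
by rewrite fsbig_seq.
Qed.

Section weighted_whitney.
Context {R : realType} {n : nat} (n0 : (0 < n)%N).
Local Notation T := (@lebesgue_space R n).
Local Notation mu := (@lebesgue_rV R n).
Variables (Omega : set 'rV[R]_n) (W : set (cube R n)) (D : R) (w : T -> R).
Hypothesis WO : whitney Omega W.
Hypothesis w_gt0 : forall x, 0 < w x.
Hypothesis w_loc : forall Q, W Q ->
  mu.-integrable (closed_cube (star Q) : set T) (EFin \o w).
Hypothesis w_dbl : doubling Omega D w.

Let w_ge0 x : 0 <= w x. Proof. exact: ltW. Qed.

Lemma star_sub Q : W Q -> cube_set (star Q) `<=` Omega.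
Proof.
move=> WQ; apply: (subset_trans _ (whitney_star_sub n0 _ _ WO _ WQ)).
exact: cube_sub_closed.
Qed.

Lemma sub_star Q : W Q -> cube_set Q `<=` cube_set (star Q).
Proof.
move=> WQ; apply: cube_sub_dilate; first exact: ltW (whitney_gt0 _ _ WO _ WQ).
by lra.
Qed.

Lemma weight_measurable : measurable_fun (Omega : set T) w.
Proof.
apply: (whitney_measurable_fun _ _ WO) => Q WQ.
have /integrableP[+ _] := w_loc _ WQ.
move=> /measurable_EFinP; apply: measurable_funS; first exact: measurable_closed_cube.
by apply: subset_trans (sub_star _ WQ) _; exact: cube_sub_closed.
Qed.

Lemma weight_measurable_sub (E : set T) : measurable E -> E `<=` Omega ->
  measurable_fun E w.
Proof.
by move=> mE EO; apply: measurable_funS weight_measurable => //; exact: (whitney_measurable _ _ WO).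
Qed.

Lemma wmeas_ge0 (E : set T) : (0 <= wmeas w E)%E.
Proof. by apply: integral_ge0 => x _; rewrite lee_fin. Qed.

Lemma wmeas_mono (E F : set T) : measurable E -> measurable F -> F `<=` Omega ->
  E `<=` F -> (wmeas w E <= wmeas w F)%E.
Proof.
move=> mE mF FO EF.
apply: (@ge0_subset_integral _ T R mu E F mE mF (fun x => (w x)%:E)).
- by apply/measurable_EFinP; exact: weight_measurable_sub.
- by move=> x _; rewrite lee_fin.
- exact: EF.
Qed.

Lemma measurable_localized (Q : cube R n) : measurable (Omega `&` cube_set Q : set T).
Proof. by apply: measurableI; [exact: (whitney_measurable _ _ WO)|exact: measurable_cube]. Qed.

(** It dominates [D] and is at least [1] whatever the sign of [D], and so are its powers. *)
Definition doubling_base : R := `|D| + 1.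

Lemma doubling_base_ge1 : 1 <= doubling_base.
Proof. by rewrite lerDr. Qed.

Lemma doubling_iter (x : 'rV[R]_n) (r t : R) (k : nat) : Omega x -> 0 < r ->
  t <= 2 ^+ k ->
  (wmeas w (Omega `&` cube_set (x, t * r)%R) <=
   (doubling_base ^+ k)%:E * wmeas w (Omega `&` cube_set (x, r)))%E.
Proof.
move=> Ox r0 tk.
apply: (@le_trans _ _ (wmeas w (Omega `&` cube_set (x, 2 ^+ k * r)%R))).
  apply: wmeas_mono; [exact: measurable_localized|exact: measurable_localized| |].
    exact: subIsetl.
  apply: setIS; apply: cube_set_sub => i /=.
  by rewrite subrr normr0 add0r ler_pM2r.
elim: k {t tk} => [|k IH]; first by rewrite !expr0 mul1r mul1e.
rewrite !exprS -mulrA.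
apply: le_trans (w_dbl _ _ Ox _) _; first by rewrite mulr_gt0// exprn_gt0.
apply: (@le_trans _ _ (doubling_base%:E * wmeas w (Omega `&` cube_set (x, 2 ^+ k * r)%R))%E).
  apply: lee_wpmul2r; first exact: wmeas_ge0.
  by rewrite lee_fin (le_trans (ler_norm _))// lerDl.
rewrite EFinM -muleA; apply: lee_wpmul2l => //.
by rewrite lee_fin (le_trans _ doubling_base_ge1).
Qed.

(** [fine] would turn an infinite value into [0]; [wmeas_cube] excludes this for cubes inside
    [star Q] with [Q] in [W]. *)
Definition mass (Q : cube R n) : R := fine (wmeas w (cube_set Q)).

Lemma mass_ge0 Q : 0 <= mass Q.
Proof. by apply: fine_ge0; exact: wmeas_ge0. Qed.

Lemma wmeas_cube (Q P : cube R n) : W Q -> cube_set P `<=` cube_set (star Q) ->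
  wmeas w (cube_set P) = (mass P)%:E.
Proof.
move=> WQ PQ; rewrite /mass fineK// ge0_fin_numE ?wmeas_ge0//.
have /integrableP[mw] := w_loc _ WQ.
apply: le_lt_trans.
rewrite (_ : (\int[_]_(x in _) _ = wmeas w (closed_cube (star Q)))%E); last first.
  by apply: eq_integral => x _; rewrite gee0_abs// lee_fin.
apply: wmeas_mono; [exact: measurable_cube|exact: measurable_closed_cube| |].
  exact: (whitney_star_sub n0 _ _ WO _ WQ).
by apply: (subset_trans PQ); exact: cube_sub_closed.
Qed.

Lemma mass_gt0 (P : cube R n) Q : W Q -> 0 < P.2 -> cube_set P `<=` cube_set (star Q) ->
  0 < mass P.
Proof.
move=> WQ P0 PQ; rewrite -lte_fin -(wmeas_cube _ _ WQ PQ).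
apply: integral_gt0_cube => //; apply: weight_measurable_sub; first exact: measurable_cube.
by apply: (subset_trans PQ); exact: star_sub.
Qed.

Lemma whitney_mass_gt0 Q : W Q -> 0 < mass Q.
Proof.
by move=> WQ; apply: (mass_gt0 _ _ WQ); [exact: (whitney_gt0 _ _ WO)|exact: sub_star].
Qed.

(** The centre of [S] lies in [star P], whose side is at most [side S / c]; hence [P] lies in the
    cube centred at [S.1] with half-side [2 / c * S.2], and doubling is applied at that centre. *)
Lemma mass_le_link (c : R) (k : nat) (P S : cube R n) : 0 < c -> 2 / c <= 2 ^+ k ->
  W P -> 0 < S.2 -> cube_set S `<=` cube_set (star P) ->
  c * side (star P) <= side S -> mass P <= doubling_base ^+ k * mass S.
Proof.
move=> c0 ck WP S0 SP cS; rewrite -lee_fin EFinM -(wmeas_cube _ _ WP SP).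
rewrite -(wmeas_cube _ _ WP (sub_star _ WP)).
have SO : cube_set S `<=` Omega by apply: (subset_trans SP); exact: star_sub.
have OS : Omega S.1 by apply: SO; exact: cube_center.
have := doubling_iter _ _ _ _ OS S0 ck.
rewrite -[in X in (_ <= X)%E](_ : S = (S.1, S.2)); last by case: (S).
rewrite (setIidr SO); apply: le_trans.
apply: wmeas_mono; [exact: measurable_cube|exact: measurable_localized|exact: subIsetl|].
rewrite subsetI; split; first exact: whitney_sub WO _ WP.
apply: (subset_trans (sub_star _ WP)); apply: cube_set_sub => i /=.
have P0 := whitney_gt0 _ _ WO _ WP.
have SQ := SP _ (cube_center _ S0) i.
have : (star P).2 * 2 <= 2 / c * S.2.
  rewrite [leRHS]mulrAC ler_pdivlMr//; move: cS; rewrite /side /star/=; lra.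
by move: SQ; rewrite /star/= => SQ h; rewrite -lerBrDr ler_norml; lra.
Qed.

Lemma dilate_mass_le (t : R) (k : nat) Q : W Q -> t <= 2 ^+ k ->
  (wmeas w (Omega `&` cube_set (dilate t Q)) <= (doubling_base ^+ k * mass Q)%:E)%E.
Proof.
move=> WQ tk; have Q0 := whitney_gt0 _ _ WO _ WQ.
have OQ : Omega Q.1 by apply: (whitney_sub _ _ WO _ WQ); exact: cube_center.
rewrite EFinM -(wmeas_cube _ _ WQ (sub_star _ WQ)).
rewrite -[in leRHS](setIidr (whitney_sub _ _ WO _ WQ)) [in leRHS](surjective_pairing Q).
exact: doubling_iter.
Qed.

Lemma sum_mass_le (I : finType) (q : I -> cube R n) (A : pred I) (E : set T) :
  injective q -> (forall i, W (q i)) -> measurable E -> E `<=` Omega ->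
  (forall i, A i -> cube_set (q i) `<=` E) ->
  ((\sum_(i | A i) mass (q i))%:E <= wmeas w E)%E.
Proof.
move=> qI Wq mE EO AE; have [_ Wt _ _] := WO.
have UE : \big[setU/set0]_(i <- enum A) cube_set (q i) `<=` E.
  rewrite -bigcup_seq => x [i] /=; rewrite mem_enum.
  by move=> Ai qx; exact: AE _ Ai _ qx.
have mU : measurable (\big[setU/set0]_(i <- enum A) cube_set (q i) : set T).
  by apply: bigsetU_measurable => i _; exact: measurable_cube.
rewrite -big_enum -sumEFin.
under eq_bigr do rewrite -(wmeas_cube _ _ (Wq _) (sub_star _ (Wq _))).
rewrite /wmeas -(@ge0_integral_bigsetU _ _ _ mu _ (fun i => cube_set (q i) : set T)).
- exact: wmeas_mono.
- by move=> i; exact: measurable_cube.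
- exact: enum_uniq.
- by move=> i j _ _ ij; apply: qI; apply: Wt.
- by apply/measurable_EFinP; apply: weight_measurable_sub => //; exact: subset_trans UE EO.
- by move=> x _; rewrite lee_fin.
Qed.

Section deviations.
Variables (u : T -> R) (p : R) (b : cube R n -> R).
Hypothesis p1 : 1 <= p.
Hypothesis u_meas : forall Q, W Q -> measurable_fun (closed_cube (star Q) : set T) u.

Definition dev (Q : cube R n) : \bar R := deviation mu w u p (b Q) (cube_set (star Q)).

Hypothesis dev_fin : forall Q, W Q -> (dev Q < +oo)%E.

(** The [a_Q] of the overview, for arbitrary constants [b Q] in place of the means. *)
Definition coef (Q : cube R n) : R := (fine (dev Q) / mass Q) `^ p^-1.

Let p0 : 0 < p. Proof. exact: lt_le_trans p1. Qed.

Lemma function_measurable : measurable_fun (Omega : set T) u.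
Proof.
apply: (whitney_measurable_fun _ _ WO) => Q WQ.
apply: measurable_funS (u_meas _ WQ); first exact: measurable_closed_cube.
by apply: subset_trans (sub_star _ WQ) _; exact: cube_sub_closed.
Qed.

Lemma function_measurable_sub (E : set T) : measurable E -> E `<=` Omega ->
  measurable_fun E u.
Proof.
by move=> mE EO; apply: measurable_funS function_measurable => //; exact: (whitney_measurable _ _ WO).
Qed.

Lemma deviation_mono (c : R) (E F : set T) : measurable E -> measurable F ->
  F `<=` Omega -> E `<=` F -> (deviation mu w u p c E <= deviation mu w u p c F)%E.
Proof.
move=> mE mF FO EF.
apply: (@ge0_subset_integral _ T R mu E F mE mF (fun x => (`|u x - c| `^ p * w x)%:E)).
- apply/measurable_EFinP; apply: measurable_dev.
    exact: weight_measurable_sub.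
  exact: function_measurable_sub.
- by move=> x _; rewrite lee_fin mulr_ge0 ?powR_ge0.
- exact: EF.
Qed.

Lemma dev_fineK Q : W Q -> dev Q = (fine (dev Q))%:E.
Proof. by move=> WQ; rewrite fineK// ge0_fin_numE ?dev_fin//; exact: deviation_ge0. Qed.

Lemma fine_dev_ge0 Q : 0 <= fine (dev Q).
Proof. by apply: fine_ge0; exact: deviation_ge0. Qed.

Lemma coef_ge0 Q : 0 <= coef Q. Proof. exact: powR_ge0. Qed.

Lemma coef_powR Q : W Q -> mass Q * coef Q `^ p = fine (dev Q).
Proof.
move=> WQ; have m0 := whitney_mass_gt0 _ WQ.
have q0 : 0 <= fine (dev Q) / mass Q := divr_ge0 (fine_dev_ge0 Q) (mass_ge0 Q).
rewrite /coef -powRrM mulVf; last by rewrite gt_eqF.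
by rewrite (powRr1 q0) mulrC divfK// gt_eqF.
Qed.

(** Both constants are compared on the common cube [S], where [u] deviates from each no more than on
    the corresponding star cube, and whose mass controls those of [P] and [Q] by doubling. *)
Lemma link_le (c : R) (k : nat) (P Q : cube R n) : 0 < c -> 2 / c <= 2 ^+ k ->
  W P -> W Q -> chain_link c P Q ->
  `|b P - b Q| <= (1 + doubling_base ^+ k) * (coef P + coef Q).
Proof.
move=> c0 ck WP WQ [S [S0 + cS]]; rewrite subsetI => -[SQ SP].
set K := doubling_base ^+ k.
have K0 : 0 <= K by rewrite exprn_ge0// (le_trans _ doubling_base_ge1).
have mS := mass_gt0 _ _ WP S0 SP.
have cP : c * side (star P) <= side S.
  by rewrite (le_trans _ cS)// ler_pM2l// le_max lexx orbT.
have cQ : c * side (star Q) <= side S.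
  by rewrite (le_trans _ cS)// ler_pM2l// le_max lexx.
have mP := mass_le_link _ _ _ _ c0 ck WP S0 SP cP.
have mQ := mass_le_link _ _ _ _ c0 ck WQ S0 SQ cQ.
have SO : cube_set S `<=` Omega by apply: (subset_trans SP); exact: star_sub.
have dS (A : cube R n) (al : R) : W A -> cube_set S `<=` cube_set (star A) -> coef A < al ->
    (deviation mu w u p (b A) (cube_set S) <= (al `^ p * mass A)%:E)%E.
  move=> WA SA h; apply: (@le_trans _ _ (dev A)).
    apply: deviation_mono => //; [exact: measurable_cube|exact: measurable_cube|].
    exact: star_sub.
  rewrite dev_fineK// lee_fin -(coef_powR _ WA) mulrC ler_wpM2r ?mass_ge0//.
  apply: ge0_ler_powR; rewrite ?nnegrE ?coef_ge0 ?(ltW p0) ?(ltW h)//.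
  exact: le_trans (coef_ge0 A) (ltW h).
apply: le_of_approx K0 (coef_ge0 P) (coef_ge0 Q) mS mP mQ _ => h h0.
have al0 : 0 < coef P + h by rewrite ltr_wpDl ?coef_ge0.
have be0 : 0 < coef Q + h by rewrite ltr_wpDl ?coef_ge0.
have := @constants_dist_le _ _ _ mu _ (measurable_cube S) w u w_ge0
  (weight_measurable_sub _ (measurable_cube S) SO)
  (function_measurable_sub _ (measurable_cube S) SO) p (b P) (b Q) _ _ _ _ p1 al0 be0
  (dS _ _ WP SP _) (dS _ _ WQ SQ _).
rewrite -/(wmeas w (cube_set S)) (wmeas_cube _ _ WP SP) -!EFinM -EFinD lee_fin.
by apply; rewrite ltrDl.
Qed.

(** * Chains and shadows in a Boman domain *)

Section boman.
Variables (c N : R) (Q0 : cube R n) (Ch : cube R n -> seq (cube R n)).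
Hypotheses (c0 : 0 < c) (N1 : 1 <= N).
Hypothesis BO : boman c N Omega W Q0 Ch.

Lemma chain_sum_le (k : nat) Q : 2 / c <= 2 ^+ k -> W Q ->
  `|b Q - b Q0| <= 2 * (1 + doubling_base ^+ k) * \sum_(P <- Ch Q) coef P.
Proof.
move=> ck WQ; have [_ [_ /(_ _ WQ)[[hd lst] Wc _ lnk]] _] := BO.
have hd' : head Q0 (Ch Q) = Q0 by case: (Ch Q) hd => //= ? ? [].
rewrite -{1}lst -{2}hd'; apply: telescope_le => [|P|j js].
- by rewrite addr_ge0// exprn_ge0// (le_trans _ doubling_base_ge1).
- exact: coef_ge0.
- apply: link_le c0 ck _ _ (lnk _ js); apply: Wc; apply: mem_nth.
    by case/andP: js => j0 js; apply: leq_ltn_trans js; exact: leq_pred.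
  by case/andP: js.
Qed.

Lemma shadow_sub P Q : W P -> W Q -> P \in Ch Q ->
  cube_set Q `<=` cube_set (dilate N P).
Proof.
move=> WP WQ PQ; have [_ _ /(_ _ WP) sh] := BO.
by apply: (subset_trans _ sh) => x Qx; exists Q.
Qed.

(** The abstract inequality applies with [K = doubling_base ^+ k]: a shadow consists of disjoint
    cubes inside [Omega] and [dilate N P], and the covering is Vitali's lemma for the cubes
    [dilate N P], whose triples are controlled since [3 * N <= 2 ^+ k]. *)
Lemma finite_shadow_sum_le (k : nat) (B : seq (cube R n)) (a : cube R n -> R) :
  3 * N <= 2 ^+ k -> uniq B -> (forall Q, Q \in B -> W Q) -> (forall P, 0 <= a P) ->
  \sum_(Q <- B) mass Q * (\sum_(P <- B | P \in Ch Q) a P) `^ p <=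
  shadow_const R (doubling_base ^+ k) p * \sum_(P <- B) mass P * a P `^ p.
Proof.
move=> Nk uB WB a0.
pose q (i : 'I_(size B)) := tnth (in_tuple B) i.
have Wq i : W (q i) by apply: WB; exact: mem_tnth.
have qI : injective q by apply/tuple_uniqP.
have q0 i := whitney_gt0 _ _ WO _ (Wq i).
have K1 : 1 <= doubling_base ^+ k by rewrite exprn_ege1// doubling_base_ge1.
rewrite (big_tnth _ _ B) [X in _ <= _ * X]big_tnth -/q.
under eq_bigr do rewrite big_tnth.
apply: (@shadow_sum_le R _ (fun i => mass (q i)) (fun i j => q i \in Ch (q j))) => //.
- by move=> i; exact: mass_ge0.
- move=> i; rewrite -lee_fin.
  apply: le_trans (dilate_mass_le N _ _ (Wq i) _); last first.
    by apply: le_trans Nk; rewrite ler_peMl ?(le_trans _ N1)// ler1n.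
  apply: (sum_mass_le _ _ _ _ qI Wq (measurable_localized _) (@subIsetl _ _ _)).
  by move=> j ij; rewrite subsetI; split; [exact: whitney_sub WO _ _|exact: shadow_sub].
- move=> A.
  have [|t [tA tdisj tcov]] := vitali_cubes _ (fun i => dilate N (q i)) [set i | A i]%SET.
    by move=> i; rewrite mulr_gt0// (lt_le_trans _ N1).
  exists t; split.
  + by move=> i /(fintype.subsetP tA); rewrite inE.
  + pose near i j := `[< cube_set (dilate N (q i)) `<=` cube_set (dilate 3 (dilate N (q j))) >].
    (* Each cube of [A] is counted for at least one selected [j], and the cubes counted for a given
       [j] are disjoint and lie in [dilate (3 * N) (q j)]. *)
    apply: (@le_trans _ _ (\sum_(j in t) \sum_(i | A i && near i j) mass (q i))).
      rewrite (exchange_big_dep A)/=; last by move=> i j _ /andP[].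
      apply: ler_sum => i Ai; have [|j jt ij] := tcov i; first by rewrite inE.
      rewrite (bigD1 j)/=; last by rewrite jt Ai; apply/asboolP.
      by rewrite lerDl sumr_ge0// => ? _; exact: mass_ge0.
    rewrite mulr_sumr; apply: ler_sum => j _; rewrite -lee_fin.
    apply: le_trans (dilate_mass_le (3 * N) _ _ (Wq j) Nk).
    apply: (sum_mass_le _ _ _ _ qI Wq (measurable_localized _) (@subIsetl _ _ _)).
    move=> i /andP[_ /asboolP ij]; rewrite subsetI; split; first exact: whitney_sub WO _ _.
    have -> : dilate (3 * N) (q j) = dilate 3 (dilate N (q j)) by rewrite /dilate/= mulrA.
    by apply: subset_trans ij; apply: cube_sub_dilate => //; exact: ltW.
  (* If [q j] is in the shadows of [q i] and [q i'], both dilates contain its centre, and their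
     disjointness for distinct indices gives [i = i']. *)
  + move=> j; apply/card_le1_eqP => i i'; rewrite !inE => /andP[it ij] /andP[i't i'j].
    apply: tdisj => //; exists (q j).1.
    by split; apply: (shadow_sub _ (q j)) => //; exact: cube_center.
Qed.

(** The leading factor comes from splitting [u - b Q0] into [u - b Q] and [b Q - b Q0]. The integers
    [k1] and [k2] count the doublings needed across a chain link and from [P] to
    [dilate (3 * N) P]. *)
Definition boman_const (k1 k2 : nat) : R :=
  2 `^ p * (1 + (2 * (1 + doubling_base ^+ k1)) `^ p *
                shadow_const R (doubling_base ^+ k2) p).

Lemma whitney_deviation_le (k : nat) Q : 2 / c <= 2 ^+ k -> W Q ->
  (deviation mu w u p (b Q0) (cube_set Q) <=
   (2 `^ p * (fine (dev Q) + (2 * (1 + doubling_base ^+ k)) `^ p *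
      (mass Q * (\sum_(P <- Ch Q) coef P) `^ p)))%:E)%E.
Proof.
move=> ck WQ; have QO := whitney_sub _ _ WO _ WQ.
have K0 : 0 <= 2 * (1 + doubling_base ^+ k).
  by rewrite mulr_ge0// addr_ge0// exprn_ge0// (le_trans _ doubling_base_ge1).
apply: (le_trans (@deviation_shift _ _ _ mu _ (measurable_cube Q) w u w_ge0
  (weight_measurable_sub _ (measurable_cube Q) QO)
  (function_measurable_sub _ (measurable_cube Q) QO) p (b Q) (b Q0) (ltW p0))).
rewrite -/(wmeas w (cube_set Q)) (wmeas_cube _ _ WQ (sub_star _ WQ)) mulrDr EFinD.
apply: leeD.
  rewrite EFinM -dev_fineK// lee_wpmul2l ?lee_fin ?powR_ge0//.
  apply: deviation_mono; [exact: measurable_cube|exact: measurable_cube|exact: star_sub|exact: sub_star].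
rewrite -EFinM lee_fin -mulrA ler_wpM2l ?powR_ge0// [leRHS]mulrCA mulrC.
have G0 : 0 <= \sum_(P <- Ch Q) coef P by apply: sumr_ge0 => P _; exact: coef_ge0.
rewrite ler_wpM2l ?mass_ge0// -(powRM _ K0 G0).
apply: ge0_ler_powR; rewrite ?nnegrE ?(ltW p0)//; first exact: mulr_ge0 K0 G0.
exact: chain_sum_le.
Qed.

Lemma boman_sum_le (k1 k2 : nat) : 2 / c <= 2 ^+ k1 -> 3 * N <= 2 ^+ k2 ->
  (deviation mu w u p (b Q0) Omega <=
   (boman_const k1 k2)%:E * \esum_(Q in W) dev Q)%E.
Proof.
move=> ck Nk.
have K1 : 1 <= doubling_base ^+ k2 by rewrite exprn_ege1// doubling_base_ge1.
set L := (2 * (1 + doubling_base ^+ k1)) `^ p.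
set SC := shadow_const R (doubling_base ^+ k2) p.
have L0 : 0 <= L by exact: powR_ge0.
have SC0 : 0 <= SC by apply: ltW; exact: shadow_const_gt0.
apply: (whitney_integral_le _ _ WO).
- by move=> x; rewrite mulr_ge0// powR_ge0.
- by apply: measurable_dev; [exact: weight_measurable|exact: function_measurable].
move=> s us sW; have [_ [_ chW] _] := BO.
(* The finite family is enlarged by the chains of its members, so that the inner sums over [B]
   contain each of these chains entirely. *)
pose B := undup (s ++ flatten (map Ch s)).
have uB : uniq B by exact: undup_uniq.
have sB : {subset s <= B} by move=> Q Qs; rewrite mem_undup mem_cat Qs.
have chB Q : Q \in s -> {subset Ch Q <= B}.
  move=> Qs P PQ; rewrite mem_undup mem_cat; apply/orP; right.
  by apply/flattenP; exists (Ch Q) => //; exact: map_f.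
have WB Q : Q \in B -> W Q.
  rewrite mem_undup mem_cat => /orP[/sW//|/flattenP[_ /mapP[P Ps ->] QP]].
  by have [_ /(_ _ QP)] := chW _ (sW _ Ps).
pose G Q := \sum_(P <- B | P \in Ch Q) coef P.
pose F Q := 2 `^ p * (fine (dev Q) + L * (mass Q * G Q `^ p)).
have F0 Q : 0 <= F Q.
  rewrite mulr_ge0 ?powR_ge0// addr_ge0 ?fine_dev_ge0//.
  by rewrite !mulr_ge0 ?mass_ge0 ?powR_ge0.
apply: (@le_trans _ _ (\sum_(Q <- s) (F Q)%:E)%E).
  rewrite big_seq [leRHS]big_seq; apply: lee_sum => Q Qs.
  have [_ _ uch _] := chW _ (sW _ Qs).
  (* A chain has no repetitions, so its sum equals the sum over the members of [B] on it. *)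
  rewrite /F /G (big_mem_uniq _ _ _ _ _ uB uch (chB _ Qs)).
  exact: whitney_deviation_le ck (sW _ Qs).
have devE : (\sum_(Q <- B) fine (dev Q))%:E = (\sum_(Q <- B) dev Q)%E.
  by rewrite -sumEFin big_seq [RHS]big_seq; apply: eq_bigr => Q /WB WQ; rewrite -dev_fineK.
apply: (@le_trans _ _ ((boman_const k1 k2)%:E * \sum_(Q <- B) dev Q)%E); last first.
  apply: lee_wpmul2l; last exact: sum_le_esum.
  by rewrite lee_fin mulr_ge0 ?powR_ge0// addr_ge0// mulr_ge0.
rewrite -devE sumEFin -EFinM lee_fin.
apply: (@le_trans _ _ (\sum_(Q <- B) F Q)).
  rewrite -(big_mem_uniq _ _ _ _ _ uB us sB) [leRHS](bigID (mem s))/= lerDl.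
  exact: sumr_ge0.
(* The first part of [F] sums to the deviations; the second is bounded by the shadow inequality with
   [a = coef]. *)
rewrite -mulr_sumr big_split/= -mulr_sumr /boman_const -mulrA.
rewrite ler_wpM2l ?powR_ge0// mulrDl mul1r lerD2l -/L -/SC -mulrA ler_wpM2l//.
apply: (le_trans (finite_shadow_sum_le _ _ _ Nk uB WB coef_ge0)).
rewrite ler_wpM2l// big_seq [leRHS]big_seq; apply: ler_sum => Q /WB WQ.
by rewrite coef_powR.
Qed.

End boman.
End deviations.
End weighted_whitney.

(** * Reduction to an everywhere positive weight, and conclusion *)

Section positivize.
Context d (T : measurableType d) (R : realType) (mu : {measure set T -> \bar R}).

(* The weight is only almost everywhere positive; changing it on a null set
   makes it positive everywhere. *)
Definition positivize (w : T -> R) (x : T) : R := if 0 < w x then w x else 1.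

Lemma positivize_gt0 w x : 0 < positivize w x.
Proof. by rewrite /positivize; case: ifP. Qed.

Lemma measurable_positivize (E : set T) w : measurable_fun E w ->
  measurable_fun E (positivize w).
Proof.
move=> mw mE; move: (mE); apply: measurable_fun_if => //.
  exact: measurable_fun_ltr.
exact: measurable_funS mw.
Qed.

Lemma integral_positivize (E F : set T) (w g : T -> R) :
  measurable E -> E `<=` F -> measurable_fun E w -> measurable_fun E g ->
  {ae mu, forall x, F x -> 0 < w x} ->
  (\int[mu]_(x in E) (g x * w x)%:E = \int[mu]_(x in E) (g x * positivize w x)%:E)%E.
Proof.
move=> mE EF mw mg [N [mN N0 wN]]; apply: ae_eq_integral => //.
- by apply/measurable_EFinP; exact: measurable_funM.
- by apply/measurable_EFinP; apply: measurable_funM => //; exact: measurable_positivize.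
exists N; split=> // x /= /not_implyP[Ex wx]; apply: wN => /= /(_ (EF _ Ex)) w0.
by apply: wx; rewrite /positivize w0.
Qed.

Lemma integrable_positivize (E F : set T) (w : T -> R) :
  measurable E -> E `<=` F -> {ae mu, forall x, F x -> 0 < w x} ->
  mu.-integrable E (EFin \o w) -> mu.-integrable E (EFin \o positivize w).
Proof.
move=> mE EF [N [mN N0 wN]] /integrableP[/measurable_EFinP mw fw].
have mv := measurable_positivize _ _ mw.
apply/integrableP; split; first exact/measurable_EFinP.
apply: le_lt_trans fw; rewrite le_eqVlt; apply/orP; left; apply/eqP.
apply: ae_eq_integral => //.
- by apply: measurableT_comp => //; exact/measurable_EFinP.
- by apply: measurableT_comp => //; exact/measurable_EFinP.
exists N; split=> // x /= /not_implyP[Ex wx]; apply: wN => /= /(_ (EF _ Ex)) w0.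
by apply: wx; rewrite /positivize w0.
Qed.

End positivize.

Lemma exists_exp2_ge (R : realType) (x : R) : exists k, x <= 2 ^+ k.
Proof.
exists (Num.bound `|x|); rewrite (le_trans (ler_norm x))//.
rewrite (le_trans (ltW (archi_boundP _)))// -natrX ler_nat ltnW// ltn_expl//.
Qed.

Theorem theorem6p9 (R : realType)
    (c : nat -> R) (hc : forall m, 0 < c m)
    (n : nat) (hn : (0 < n)%N)
    (p D N : R) (hp : 1 <= p) (hN : 1 <= N) :
  exists C : R, 0 < C /\
    forall (Omega : set 'rV[R]_n) (W : set (cube R n))
           (Q0 : cube R n) (Ch : cube R n -> seq (cube R n))
           (w u : 'rV[R]_n -> R),
      whitney Omega W ->
      boman (c n) N Omega W Q0 Ch ->
      weight Omega w -> doubling Omega D w ->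
      L1loc Omega w u ->
      (\int[lebesgue_rV n]_(x in Omega)
          (`|u x - wmean w (cube_set (star Q0)) u| `^ p * w x)%:E
        <= C%:E * \esum_(Q in W)
             \int[lebesgue_rV n]_(x in cube_set (star Q))
                (`|u x - wmean w (cube_set (star Q)) u| `^ p * w x)%:E)%E.
Proof.
(* Both exponents depend on [c n] and [N] only, so the constant is fixed before the domain, the
   weight and the function. *)
have [k1 hk1] := exists_exp2_ge _ (2 / c n).
have [k2 hk2] := exists_exp2_ge _ (3 * N).
have K1 k : 1 <= doubling_base D ^+ k by rewrite exprn_ege1// doubling_base_ge1.
have C0 : 0 < boman_const D p k1 k2.
  rewrite mulr_gt0 ?powR_gt0// ltr_pwDl// mulr_ge0 ?powR_ge0// ltW//.
  exact: shadow_const_gt0.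
exists (boman_const D p k1 k2); split=> // Omega W Q0 Ch w u WO BO [w_loc w_ae] w_dbl u_loc.
pose T := @lebesgue_space R n; pose mu := @lebesgue_rV R n.
have starO Q : W Q -> closed_cube (star Q) `<=` Omega := whitney_star_sub hn _ _ WO Q.
have w_star Q : W Q -> mu.-integrable (closed_cube (star Q) : set T) (EFin \o w).
  by move=> WQ; apply: w_loc (starO _ WQ); exact: compact_closed_cube.
have u_star Q : W Q -> measurable_fun (closed_cube (star Q) : set T) (u : T -> R).
  by move=> WQ; have [] := u_loc _ (compact_closed_cube _) (starO _ WQ).
have mO : measurable (Omega : set T) := whitney_measurable _ _ WO.
have mw : measurable_fun (Omega : set T) (w : T -> R) by exact: (weight_measurable _ _ _ WO w_star).
have mu_ : measurable_fun (Omega : set T) (u : T -> R) by exact: (function_measurable _ _ WO _ u_star).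
pose v : T -> R := positivize _ T R w.
have wvE (E : set T) (g : T -> R) : measurable E -> E `<=` Omega -> measurable_fun E g ->
    (\int[mu]_(x in E) (g x * w x)%:E = \int[mu]_(x in E) (g x * v x)%:E)%E.
  move=> mE EO mg.
  exact: (integral_positivize _ _ _ _ _ _ _ _ mE EO (measurable_funS mO EO mw) mg w_ae).
have wv_meas (E : set T) : measurable E -> E `<=` Omega -> wmeas w E = wmeas v E.
  move=> mE EO; have := wvE E (cst 1) mE EO (measurable_cst _).
  by under eq_integral do rewrite mul1r; under [RHS]eq_integral do rewrite mul1r.
have v_star Q : W Q -> mu.-integrable (closed_cube (star Q) : set T) (EFin \o v).
  move=> WQ; have mK : measurable (closed_cube (star Q) : set T) := measurable_closed_cube _.
  exact: (integrable_positivize _ _ _ _ _ _ _ mK (starO _ WQ) w_ae (w_star _ WQ)).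
have v_dbl : doubling Omega D v.
  move=> x r Ox r0; have mC (Q : cube R n) : measurable (Omega `&` cube_set Q : set T).
    by apply: measurableI => //; exact: measurable_cube.
  by rewrite -!wv_meas//; exact: w_dbl.
(* The constants remain the means taken with [w]; only the weight under the integral is replaced by
   [v]. *)
pose b Q := wmean w (cube_set (star Q)) u.
have devE (E : set T) a : measurable E -> E `<=` Omega ->
    (\int[mu]_(x in E) (`|u x - a| `^ p * w x)%:E)%E = deviation mu v u p a E.
  move=> mE EO; apply: (wvE E (fun x => `|u x - a| `^ p) mE EO).
  apply: (measurableT_comp (measurable_powR _)).
  apply: measurableT_comp; first exact: normr_measurable.
  by apply: measurable_funB; [exact: (measurable_funS mO EO mu_)|exact: measurable_cst].
have -> : (\esum_(Q in W) \int[mu]_(x in cube_set (star Q))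
    (`|u x - wmean w (cube_set (star Q)) u| `^ p * w x)%:E =
    \esum_(Q in W) dev v u p b Q)%E.
  apply: eq_esum => Q WQ; apply: devE; first exact: measurable_cube.
  exact: (star_sub hn _ _ WO _ WQ).
rewrite [leLHS](devE _ (b Q0) mO (@subset_refl _ _)).
case: (pselect (forall Q, W Q -> (dev v u p b Q < +oo)%E)) => [fin|].
  by apply: (@boman_sum_le _ _ hn Omega W D v WO (positivize_gt0 _ _ _ _) v_star v_dbl
    u p b hp u_star fin (c n) N Q0 Ch).
(* If some deviation is infinite, so is the right-hand side, because the constant is positive. *)
move=> /existsNP[Q /not_implyP[WQ /negP]]; rewrite -leNgt leye_eq => /eqP Qoo.
have -> : (\esum_(P in W) dev v u p b P = +oo)%E.
  have := sum_le_esum _ _ W (dev v u p b) [:: Q] isT; rewrite big_seq1 Qoo leye_eq.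
  by move=> /(_ _)/eqP -> // P; rewrite inE => /eqP ->.
by rewrite gt0_muley ?lte_fin// leey.
Qed.
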